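(* Let $\Bbbk$ be a field of characteristic zero, let $U(3)$ and $M_{(0,\Delta)}$ be as defined below, and let $\Delta\in\Bbbk$, $\Delta\neq0$. Then \[ \dim_\Bbbk H^2(U(3),M_{(0,\Delta)})=\begin{cases}1, & \Delta=1,\\ 0, & \Delta\neq 0,1.\end{cases} \]
   Context: A conformal algebra over $\Bbbk$ is a $\Bbbk[\partial]$-module $C$ with a bilinear $\lambda$-product $(a\,{}_{\lambda}\,b)=\sum_{n\ge0}\frac{\lambda^n}{n!}(a\,{}_{(n)}\,b)\in C[\lambda]$ satisfying $(\partial a\,{}_\lambda\, b)=-\lambda(a\,{}_\lambda\, b)$ and $(a\,{}_\lambda\,\partial b)=(\partial+\lambda)(a\,{}_\lambda\, b)$; it is associative if $a\,{}_\lambda(b\,{}_\mu c)=(a\,{}_\lambda b)\,{}_{\lambda+\mu} c$. $U(3)$ is the associative conformal algebra generated by one element $v$ subject to $v\,{}_{(n)}\,v=0$ for $n\ge 3$ and $2\,v\,{}_{(1)}\,v-\partial(v\,{}_{(2)}\,v)=2v$. A left conformal module over an associative conformal algebra $C$ is a $\Bbbk[\partial]$-module $M$ with a bilinear map $a\otimes m\mapsto a\,{}_\lambda m\in M[\lambda]$ satisfying $(\partial a)\,{}_\lambda m=-\lambda(a\,{}_\lambda m)$, $a\,{}_\lambda\,\partial m=(\partial+\lambda)(a\,{}_\lambda m)$, $a\,{}_\lambda(b\,{}_\mu m)=(a\,{}_\lambda b)\,{}_{\lambda+\mu}m$. $M_{(0,\Delta)}=\Bbbk[\partial]u$ with $v\,{}_\lambda\,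 u=(\partial+\Delta\lambda)u$, a conformal $U(3)$-module. Hochschild cohomology: the basic complex $\tilde C^n(C,M)$ ($n\ge1$) consists of maps $\varphi_{\bar\lambda}:C^{\otimes n}\to M[\lambda_1,\dots,\lambda_n]$ with $\varphi_{\bar\lambda}(a_1,\dots,\partial a_i,\dots,a_n)=-\lambda_i\varphi_{\bar\lambda}(a_1,\dots,a_n)$, $\tilde C^0=M$, with differential $(d\varphi)_{\bar\lambda}(a_1,\dots,a_{n+1})=a_1\,{}_{\lambda_1}\varphi_{(\lambda_2,\dots,\lambda_{n+1})}(a_2,\dots,a_{n+1})+\sum_{i=1}^n(-1)^i\varphi_{(\lambda_1,\dots,\lambda_i+\lambda_{i+1},\dots,\lambda_{n+1})}(a_1,\dots,a_i\,{}_{\lambda_i}a_{i+1},\dots,a_{n+1})$ (for $n=0$: $(dm)_\lambda(a)=a\,{}_\lambda m$). $\partial$ acts on $\tilde C^n$ by $(\partial\varphi)_{\bar\lambda}=(\partial+\sum_i\lambda_i)\varphi_{\bar\lambda}$, commuting with $d$; $H^n(C,M)$ is the cohomology of the reduced complex $\tilde C^\bullet(C,M)/\partial\tilde C^\bullet(C,M)$. *)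

(* Defs.v *)
From HB Require Import structures.
From mathcomp Require Import all_boot all_algebra.
From mathcomp Require Import mpoly.
Set Implicit Arguments. Unset Strict Implicit. Unset Printing Implicit Defensive.
Import GRing.Theory.
Local Open Scope ring_scope.

(* A conformal algebra is a k[d]-module C, i.e. a K-vector space with  *)
(* a K-linear endomorphism [cder] (= d), with K-bilinear n-products    *)
(* a (n) b = [cprod n a b]; [cloc] is a locality bound, so that        *)
(* (a _lambda b) = \sum_(n < cloc a b) lambda^n/n! (a (n) b) in C[l].  *)
Record confStr (K : fieldType) (C : lmodType K) := ConfStr {
  cder : C -> C;
  cprod : nat -> C -> C -> C;
  cloc : C -> C -> nat }.

(* The axioms (d a)_l b = -l (a_l b), a_l (d b) = (d+l)(a_l b), and     *)
(* associativity a_l (b_m c) = (a_l b)_(l+m) c, written coefficientwise. *)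
Definition is_assoc_conf (K : fieldType) (C : lmodType K) (S : confStr C) : Prop :=
  (forall (c : K) (a b : C), cder S (c *: a + b) = c *: cder S a + cder S b) /\
      (forall n (c : K) (a a' b : C),
          cprod S n (c *: a + a') b = c *: cprod S n a b + cprod S n a' b) /\
      (forall n (c : K) (a b b' : C),
          cprod S n a (c *: b + b') = c *: cprod S n a b + cprod S n a b') /\
      (forall (a b : C) n, (cloc S a b <= n)%N -> cprod S n a b = 0) /\
      (forall n (a b : C), cprod S n (cder S a) b = - (cprod S n.-1 a b *+ n)) /\
      (forall n (a b : C),
          cprod S n a (cder S b) = cder S (cprod S n a b) + cprod S n.-1 a b *+ n) /\
      (forall m n (a b c : C),
          cprod S m a (cprod S n b c)
          = \sum_(s < m.+1) cprod S (m + n - s) (cprod S s a b) c *+ 'C(m, s)).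

Definition conf_morph (K : fieldType) (C D : lmodType K)
    (S : confStr C) (T : confStr D) (f : C -> D) : Prop :=
  [/\ (forall (c : K) (a b : C), f (c *: a + b) = c *: f a + f b),
      (forall a, f (cder S a) = cder T (f a))
    & (forall n a b, f (cprod S n a b) = cprod T n (f a) (f b))].

Definition U3_rel (K : fieldType) (C : lmodType K) (S : confStr C) (v : C) : Prop :=
  (forall n, (3 <= n)%N -> cprod S n v v = 0) /\
  cprod S 1 v v *+ 2 - cder S (cprod S 2 v v) = v *+ 2.

(* (C, S, v) is U(3): the associative conformal algebra generated by v
   subject to the relations, i.e. the initial object among associative
   conformal algebras with a distinguished element satisfying them. *)
Definition is_U3 (K : fieldType) (C : lmodType K) (S : confStr C) (v : C) : Prop :=
  [/\ is_assoc_conf S, U3_rel S v &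
      forall (D : lmodType K) (T : confStr D) (w : D),
        is_assoc_conf T -> U3_rel T w ->
        exists f : C -> D,
          [/\ conf_morph S T f, f v = w &
              forall g : C -> D, conf_morph S T g -> g v = w -> forall a, g a = f a]].

(* Polynomials: M = K[d]u, and M[l_1,...,l_n] is identified with        *)
(* {mpoly K[n.+1]}, variable 0 being d and variable i being l_i.        *)
Definition Xv (K : fieldType) (n k : nat) : {mpoly K[n.+1]} := 'X_(inord k).

Definition lamc (K : fieldType) (n i k : nat) : {mpoly K[n.+1]} :=
  (k`!%:R : K)^-1 *: (Xv K n i) ^+ k.

(* A left conformal module structure on M = K[d]u is determined by
   rho a := a_l u in M[l] = K[d,l] (by sesquilinearity,
   a_l (p(d)u) = p(d+l) (a_l u)). The module axioms read: *)
Definition is_conf_module (K : fieldType) (C : lmodType K) (S : confStr C)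
    (rho : C -> {mpoly K[2]}) : Prop :=
  [/\ (forall (c : K) (a b : C), rho (c *: a + b) = c *: rho a + rho b),
      (forall a, rho (cder S a) = - (Xv K 1 1 * rho a))
    & (forall a b : C,
          (* a_l (b_m u) = (a_l b)_(l+m) u   in K[d,l,m] *)
          comp_mpoly [tuple Xv K 2 0 + Xv K 2 1; Xv K 2 2] (rho b)
            * comp_mpoly [tuple Xv K 2 0; Xv K 2 1] (rho a)
          = \sum_(k < cloc S a b)
              lamc K 2 1 k * comp_mpoly [tuple Xv K 2 0; Xv K 2 1 + Xv K 2 2]
                                        (rho (cprod S k a b)))].

Definition cochain1 (K : fieldType) (C : lmodType K) (S : confStr C)
    (phi : C -> {mpoly K[2]}) : Prop :=
  (forall (c : K) a b, phi (c *: a + b) = c *: phi a + phi b) /\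
  (forall a, phi (cder S a) = - (Xv K 1 1 * phi a)).

Definition cochain2 (K : fieldType) (C : lmodType K) (S : confStr C)
    (phi : C -> C -> {mpoly K[3]}) : Prop :=
  [/\ (forall (c : K) a a' b, phi (c *: a + a') b = c *: phi a b + phi a' b),
      (forall (c : K) a b b', phi a (c *: b + b') = c *: phi a b + phi a b'),
      (forall a b, phi (cder S a) b = - (Xv K 2 1 * phi a b))
    & (forall a b, phi a (cder S b) = - (Xv K 2 2 * phi a b))].

Definition cochain3 (K : fieldType) (C : lmodType K) (S : confStr C)
    (phi : C -> C -> C -> {mpoly K[4]}) : Prop :=
  (forall (c : K) a a' b e, phi (c *: a + a') b e = c *: phi a b e + phi a' b e) /\
      (forall (c : K) a b b' e, phi a (c *: b + b') e = c *: phi a b e + phi a b' e) /\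
      (forall (c : K) a b e e', phi a b (c *: e + e') = c *: phi a b e + phi a b e') /\
      (forall a b e, phi (cder S a) b e = - (Xv K 3 1 * phi a b e)) /\
      (forall a b e, phi a (cder S b) e = - (Xv K 3 2 * phi a b e)) /\
      (forall a b e, phi a b (cder S e) = - (Xv K 3 3 * phi a b e)).

(* action of d on cochains: (d phi)_l = (d + l_1 + ... + l_n) phi_l *)
Definition del2 (K : fieldType) (C : lmodType K)
    (phi : C -> C -> {mpoly K[3]}) : C -> C -> {mpoly K[3]} :=
  fun a b => (Xv K 2 0 + Xv K 2 1 + Xv K 2 2) * phi a b.

Definition del3 (K : fieldType) (C : lmodType K)
    (phi : C -> C -> C -> {mpoly K[4]}) : C -> C -> C -> {mpoly K[4]} :=
  fun a b e => (Xv K 3 0 + Xv K 3 1 + Xv K 3 2 + Xv K 3 3) * phi a b e.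

Definition hd1 (K : fieldType) (C : lmodType K) (S : confStr C)
    (rho : C -> {mpoly K[2]}) (phi : C -> {mpoly K[2]}) : C -> C -> {mpoly K[3]} :=
  fun a1 a2 =>
    (* a1_{l1} phi_{l2}(a2) *)
    comp_mpoly [tuple Xv K 2 0; Xv K 2 1] (rho a1)
      * comp_mpoly [tuple Xv K 2 0 + Xv K 2 1; Xv K 2 2] (phi a2)
    (* - phi_{l1+l2}(a1 _{l1} a2) *)
    - \sum_(k < cloc S a1 a2)
        lamc K 2 1 k * comp_mpoly [tuple Xv K 2 0; Xv K 2 1 + Xv K 2 2]
                                  (phi (cprod S k a1 a2)).

Definition hd2 (K : fieldType) (C : lmodType K) (S : confStr C)
    (rho : C -> {mpoly K[2]}) (phi : C -> C -> {mpoly K[3]})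
    : C -> C -> C -> {mpoly K[4]} :=
  fun a1 a2 a3 =>
    comp_mpoly [tuple Xv K 3 0; Xv K 3 1] (rho a1)
      * comp_mpoly [tuple Xv K 3 0 + Xv K 3 1; Xv K 3 2; Xv K 3 3] (phi a2 a3)
    - \sum_(k < cloc S a1 a2)
        lamc K 3 1 k * comp_mpoly [tuple Xv K 3 0; Xv K 3 1 + Xv K 3 2; Xv K 3 3]
                                  (phi (cprod S k a1 a2) a3)
    + \sum_(k < cloc S a2 a3)
        lamc K 3 2 k * comp_mpoly [tuple Xv K 3 0; Xv K 3 1; Xv K 3 2 + Xv K 3 3]
                                  (phi a1 (cprod S k a2 a3)).

(* 2-cocycles and 2-coboundaries of the reduced complex C~/dC~ *)
Definition red_cocycle2 (K : fieldType) (C : lmodType K) (S : confStr C)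
    (rho : C -> {mpoly K[2]}) (phi : C -> C -> {mpoly K[3]}) : Prop :=
  cochain2 S phi /\
  exists chi, cochain3 S chi /\
    forall a b e, hd2 S rho phi a b e = del3 chi a b e.

Definition red_coboundary2 (K : fieldType) (C : lmodType K) (S : confStr C)
    (rho : C -> {mpoly K[2]}) (phi : C -> C -> {mpoly K[3]}) : Prop :=
  cochain2 S phi /\
  exists psi chi, [/\ cochain1 S psi, cochain2 S chi &
    forall a b, phi a b = hd1 S rho psi a b + del2 chi a b].

Definition H2_dim (K : fieldType) (C : lmodType K) (S : confStr C)
    (rho : C -> {mpoly K[2]}) (n : nat) : Prop :=
  exists B : 'I_n -> C -> C -> {mpoly K[3]},
    [/\ (forall i, red_cocycle2 S rho (B i)),
        (forall c : 'I_n -> K,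
            red_coboundary2 S rho (fun a b => \sum_(i < n) c i *: B i a b) ->
            forall i, c i = 0)
      & (forall phi, red_cocycle2 S rho phi ->
            exists c : 'I_n -> K,
              red_coboundary2 S rho (fun a b => phi a b - \sum_(i < n) c i *: B i a b))].

(* Main.v *)
(** Modulo [d + l1 + l2], a 2-cocycle [phi] is the same thing as a square-zero extension [E] of [U(3)]
by [M] with zero right action, and [phi] is a coboundary iff [E] splits. By the universal property of
[U(3)] this happens iff some lift [V = v + f(d) u] of the generator satisfies the defining relations
in [E]. Choosing [f] so that [V_l V] is constant in [l] at [d = 0] (possible since [Delta <> 0]), the
associativity of [V (m) (V (n) V)], read at [d = 0], forces [V (n) V = 0] for [n >= 3] and
[2 V (1) V - d (V (2) V) - 2 V] to be a constant multiple of [u]. Adding [c u] to [V] changes that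
constant by [2 (Delta - 1) c], so it can be removed when [Delta <> 1]; when [Delta = 1] it is twice
the coefficient of [l] in [phi_l(v, v)] at [d = 0], which vanishes on coboundaries.

For [Delta = 1] a cocycle with nonzero class is the product of two 1-cocycles: the derivative in
[Delta] of the family of modules [M_(0,Delta)], and the derivation of [U(3)] into [M_(0,1)] sending
[v] to [u]. Both are obtained by applying the universal property to split extensions of [U(3)]. *)

Require Import Defs.
From HB Require Import structures.
From mathcomp Require Import all_boot all_algebra.
From mathcomp Require Import mpoly.
From mathcomp Require Import ring zify.
Set Implicit Arguments. Unset Strict Implicit. Unset Printing Implicit Defensive.
Import GRing.Theory.
Local Open Scope ring_scope.

(** * Polynomial identities checked pointwise *)

Lemma natf_neq0_pchar0 (K : fieldType) (hK : [pchar K] =i pred0) (n : nat) :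
  (0 < n)%N -> (n%:R : K) != 0.
Proof. by move=> n_gt0; rewrite ((pcharf0P K).1 hK) -lt0n. Qed.

(** In characteristic zero the elements [0, 1, 2, ...] are distinct, so a nonzero difference would
    have too many roots. *)
Lemma poly_ext (K : fieldType) (hK : [pchar K] =i pred0) (p q : {poly K}) :
  (forall x, p.[x] = q.[x]) -> p = q.
Proof.
move=> epq; apply/eqP; rewrite -subr_eq0; apply/eqP.
pose rs := [seq (i%:R : K) | i <- iota 0 (size (p - q))].
apply: (@roots_geq_poly_eq0 K _ rs); last by rewrite size_map size_iota.
  by apply/allP => x _; rewrite rootE !hornerE epq subrr.
rewrite map_inj_uniq ?iota_uniq // => i j /=.
wlog le_ij : i j / (i <= j)%N => [IH eij|eij].
  by case/orP: (leq_total i j) => /IH; [exact|move/(_ (esym eij))].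
apply/eqP; rewrite eqn_leq le_ij /= -subn_eq0.
by rewrite -((pcharf0P K).1 hK) natrB // eij subrr.
Qed.

Lemma meval_muni (K : fieldType) n (p : {mpoly K[n.+1]}) (v : 'I_n.+1 -> K) :
  p.@[v] = (map_poly (meval (fun i => v (widen_ord (leqnSn n) i))) (muni p)).[v ord_max].
Proof.
rewrite muniE mevalE raddf_sum horner_sum; apply: eq_bigr => m _ /=.
rewrite -mul_polyC rmorphM /= map_polyC map_polyXn !hornerE /= mevalZ.
rewrite mevalX big_ord_recr /= mulrA; congr (_ * _ * _).
by apply: eq_bigr => i _; rewrite mnmE.
Qed.

(** Induction on [n]: as a polynomial in the last variable, [p] vanishes at every value of that
    variable, so all its coefficients vanish at every point of [K^n]. *)
Lemma mpoly_eq0_meval (K : fieldType) (hK : [pchar K] =i pred0) n (p : {mpoly K[n]}) :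
  (forall v, p.@[v] = 0) -> p = 0.
Proof.
elim: n p => [|n IH] p p0.
  by have := p0 (fun=> 0); rewrite (nvar0_mpolyC p) mevalC => ->; rewrite mpolyC0.
(* The coefficient of [p] at [m] is read off from [muni p] at degree [m ord_max] and the remaining
   exponents. *)
suff muni0 : muni p = 0.
  apply/mpolyP => m; rewrite mcoeff0.
  have /(congr1 (fun q : {poly {mpoly K[n]}} =>
     (q`_(m ord_max))@_[multinom m (widen_ord (leqnSn n) i) | i < n])) := muni0.
  rewrite coef0 mcoeff0 muniE coef_sum raddf_sum /= => sum0.
  rewrite -[RHS]sum0 [in LHS](mpolyE p) raddf_sum /=; apply: eq_bigr => m' _.
  rewrite mcoeffZ mcoeffX coefZ coefXn.
  case: (m' =P m) => [->|neq]; first by rewrite !eqxx !mulr1 mcoeffZ mcoeffX eqxx mulr1.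
  case: (m ord_max =P m' ord_max) => [emax|_]; last by rewrite mulr0 mulr0 mcoeff0.
  rewrite !mulr1 mcoeffZ mcoeffX; case: eqP => // /mnmP eqm; case: neq; apply/mnmP => i.
  case: (unliftP ord_max i) => [j ->|->] //.
  have := eqm j; rewrite !mnmE; congr (m' _ = m _); apply: val_inj => /=;
    by rewrite /bump leqNgt ltn_ord.
apply/polyP => i; rewrite coef0; apply: IH => v.
have /polyP/(_ i) : map_poly (meval v) (muni p) = 0.
  apply: (poly_ext hK) => x; rewrite horner0.
  rewrite -[RHS](p0 (fun j => if unlift ord_max j is Some j' then v j' else x)).
  rewrite meval_muni unlift_none; congr (_.[_]); apply: eq_map_poly => q.
  apply: meval_eq => j; have -> : widen_ord (leqnSn n) j = lift ord_max j.
    by apply: val_inj; rewrite /= /bump leqNgt ltn_ord.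
  by rewrite liftK.
by rewrite coef_map coef0.
Qed.

Lemma mpoly_ext (K : fieldType) (hK : [pchar K] =i pred0) n (p q : {mpoly K[n]}) :
  (forall v, p.@[v] = q.@[v]) -> p = q.
Proof.
move=> epq; apply/eqP; rewrite -subr_eq0; apply/eqP.
by apply: (mpoly_eq0_meval hK) => v; rewrite mevalB epq subrr.
Qed.

(** * Values of polynomials at explicit points *)

Definition point (K : fieldType) (s : seq K) n (i : 'I_n) : K := s`_i.
Arguments point {K} s {n} i.

Section Values.
Variable K : fieldType.

Lemma meval_Xv n k (v : 'I_n.+1 -> K) : (Xv K n k).@[v] = v (inord k).
Proof. exact: mevalXU. Qed.

Lemma meval_lamc n i k (v : 'I_n.+1 -> K) :
  (lamc K n i k).@[v] = (k`!%:R)^-1 * v (inord i) ^+ k.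
Proof. by rewrite mevalZ rmorphXn /= meval_Xv. Qed.

Lemma meval_comp2 n (a b : {mpoly K[n]}) p v :
  (comp_mpoly [tuple a; b] p).@[v] = p.@[point [:: a.@[v]; b.@[v]]].
Proof.
rewrite comp_mpoly_meval; apply: meval_eq => i.
by rewrite (tnth_nth 0) /point; case: i => [[|[|i]]].
Qed.

Lemma meval_comp3 n (a b c : {mpoly K[n]}) p v :
  (comp_mpoly [tuple a; b; c] p).@[v] = p.@[point [:: a.@[v]; b.@[v]; c.@[v]]].
Proof.
rewrite comp_mpoly_meval; apply: meval_eq => i.
by rewrite (tnth_nth 0) /point; case: i => [[|[|[|i]]]].
Qed.

Lemma point_inord n (s : seq K) k : (k < n.+1)%N -> point s (inord k : 'I_n.+1) = s`_k.
Proof. by move=> le_kn; rewrite /point inordK. Qed.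

End Values.

(** * Exponential generating functions *)

Section Egf.
Variable K : fieldType.
Hypothesis hK : [pchar K] =i pred0.
Implicit Types (c : nat -> K) (g : K -> K) (F : nat -> nat -> K) (f : K -> K -> K).

(** Relates the [n]-products of two elements to their [lambda]-product at [lambda = x]. By
    [egf_inj], coefficientwise axioms become identities between functions. *)
Definition is_egf c g : Prop := exists N,
  (forall n, (N <= n)%N -> c n = 0) /\
  forall x, g x = \sum_(n < N) (n`!%:R)^-1 * x ^+ n * c n.

Lemma fact_neq0 n : (n`!%:R : K) != 0.
Proof. exact/natf_neq0_pchar0/fact_gt0. Qed.

Lemma egf_widen N N' c x : (N <= N')%N -> (forall n, (N <= n)%N -> c n = 0) ->
  \sum_(n < N) (n`!%:R)^-1 * x ^+ n * c n = \sum_(n < N') (n`!%:R)^-1 * x ^+ n * c n.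
Proof.
move=> leN c0; rewrite (big_ord_widen _ (fun n => (n`!%:R)^-1 * x ^+ n * c n) leN).
rewrite [RHS](bigID (fun n : 'I_N' => (n < N)%N)) /= [X in _ + X]big1 ?addr0 // => n.
by rewrite -leqNgt => /c0 ->; rewrite mulr0.
Qed.

Lemma eq_egf c c' g g' : is_egf c g -> c =1 c' -> g =1 g' -> is_egf c' g'.
Proof.
move=> [N [c0 gE]] ec eg; exists N; split=> [n /c0|x]; first by rewrite ec.
by rewrite -eg gE; apply: eq_bigr => n _; rewrite ec.
Qed.

Lemma egf_bounded N c : (forall n, (N <= n)%N -> c n = 0) ->
  is_egf c (fun x => \sum_(n < N) (n`!%:R)^-1 * x ^+ n * c n).
Proof. by move=> c0; exists N. Qed.

Lemma egf0 : is_egf (fun=> 0) (fun=> 0).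
Proof. by exists 0%N; split=> // x; rewrite big_ord0. Qed.

Lemma egfD c c' g g' : is_egf c g -> is_egf c' g' ->
  is_egf (fun n => c n + c' n) (fun x => g x + g' x).
Proof.
move=> [N [c0 gE]] [N' [c'0 g'E]]; exists (maxn N N'); split=> [n|x].
  by rewrite geq_max => /andP[/c0 -> /c'0 ->]; rewrite addr0.
rewrite gE g'E (egf_widen _ (leq_maxl N N') c0) (egf_widen _ (leq_maxr N N') c'0).
by rewrite -big_split; apply: eq_bigr => n _; rewrite mulrDr.
Qed.

Lemma egfZ k c g : is_egf c g -> is_egf (fun n => k * c n) (fun x => k * g x).
Proof.
move=> [N [c0 gE]]; exists N; split=> [n /c0 ->|x]; first by rewrite mulr0.
by rewrite gE big_distrr; apply: eq_bigr => n _; rewrite mulrCA.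
Qed.

Lemma egf_inj c c' g g' : is_egf c g -> is_egf c' g' -> g =1 g' -> c =1 c'.
Proof.
move=> cg c'g' egg' n; apply/eqP; rewrite -subr_eq0; apply/eqP.
have [N [d0 dE]] := egfD cg (egfZ (-1) c'g').
case: (leqP N n) => [/d0|ltnN]; first by rewrite mulN1r.
pose p := \poly_(i < N) ((i`!%:R)^-1 * (c i + -1 * c' i)).
have p0 : p = 0.
  apply: (poly_ext hK) => x; rewrite horner0 horner_poly.
  have := dE x; rewrite egg' mulN1r subrr => dE0; rewrite [RHS]dE0.
  by apply: eq_bigr => i _; rewrite mulrAC.
have := congr1 (fun q : {poly K} => q`_n) p0.
rewrite coef_poly ltnN coef0 mulN1r => /eqP.
by rewrite mulf_eq0 invr_eq0 (negPf (fact_neq0 n)) => /eqP.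
Qed.

(** This is [x * x^n/n! = (n+1) x^(n+1)/(n+1)!]. At index [0] the predecessor is again [0], but the
    factor [n] kills the term, as in the sesquilinearity axioms. *)
Lemma egf_shift c g : is_egf c g ->
  is_egf (fun n => c n.-1 *+ n) (fun x => x * g x).
Proof.
move=> [N [c0 gE]]; exists N.+1; split=> [[|n] //|x]; first by move/c0=> /= ->; rewrite mul0rn.
rewrite gE big_ord_recl /= mulr0n mulr0 add0r big_distrr; apply: eq_bigr => n _.
rewrite /bump /= add1n add0n factS natrM invfM exprS -[c n *+ _]mulr_natl.
have := natf_neq0_pchar0 hK (ltn0Sn n); move: (n.+1%:R) => k k0.
by field; rewrite k0 fact_neq0.
Qed.

Lemma horner_egf (A : nzRingType) (e : {rmorphism A -> K}) (q : {poly A}) N x :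
  (size q <= N)%N ->
  (map_poly e q).[x] = \sum_(n < N) (n`!%:R)^-1 * x ^+ n * e (q`_n *+ n`!).
Proof.
move=> le_qN; rewrite (horner_coef_wide _ (leq_trans (size_poly _ _) le_qN)).
apply: eq_bigr => n _; rewrite coef_map rmorphMn -mulr_natl /=.
by field; rewrite fact_neq0.
Qed.

Lemma egf_poly (A : nzRingType) (e : {rmorphism A -> K}) (q : {poly A}) :
  is_egf (fun n => e (q`_n *+ n`!)) (fun x => (map_poly e q).[x]).
Proof.
exists (size q); split=> [n le_n|x]; last exact: horner_egf.
by rewrite nth_default // mul0rn rmorph0.
Qed.

(** The function [h n] is the partial sum over the first index, so two applications of the
    one-variable theory replace bivariate polynomials. *)
Definition is_egf2 (F : nat -> nat -> K) (f : K -> K -> K) : Prop :=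
  exists h : nat -> K -> K,
    (forall n, is_egf (fun m => F m n) (h n)) /\
    (forall x, is_egf (fun n => h n x) (f x)).

Lemma eq_egf2 F F' f f' : is_egf2 F f -> F =2 F' -> f =2 f' -> is_egf2 F' f'.
Proof.
move=> [h [Fh hg]] eF eg; exists h; split=> [n|x].
  by apply: eq_egf (Fh n) _ _.
by apply: eq_egf (hg x) _ _.
Qed.

Lemma egf2_inj F F' f f' : is_egf2 F f -> is_egf2 F' f' -> f =2 f' -> F =2 F'.
Proof.
move=> [h [Fh hg]] [h' [Fh' hg']] eg m n.
exact: (egf_inj (Fh n) (Fh' n) (fun x => egf_inj (hg x) (hg' x) (eg x) n)).
Qed.

Lemma egf20 : is_egf2 (fun _ _ => 0) (fun _ _ => 0).
Proof. by exists (fun _ _ => 0); split=> _; apply: egf0. Qed.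

Lemma egf2D F F' f f' : is_egf2 F f -> is_egf2 F' f' ->
  is_egf2 (fun m n => F m n + F' m n) (fun x y => f x y + f' x y).
Proof.
move=> [h [Fh hg]] [h' [Fh' hg']]; exists (fun n x => h n x + h' n x).
by split=> ?; apply: egfD.
Qed.

Lemma egf2Z k F f : is_egf2 F f -> is_egf2 (fun m n => k * F m n) (fun x y => k * f x y).
Proof.
by move=> [h [Fh hg]]; exists (fun n x => k * h n x); split=> ?; apply: egfZ.
Qed.

Lemma egf2_sumr (I : Type) (r : seq I) (F : I -> nat -> nat -> K) (f : I -> K -> K -> K) :
  (forall i, is_egf2 (F i) (f i)) ->
  is_egf2 (fun m n => \sum_(i <- r) F i m n) (fun x y => \sum_(i <- r) f i x y).
Proof.
move=> Fg; elim: r => [|i r IH].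
  by apply: eq_egf2 egf20 _ _ => ? ?; rewrite big_nil.
by apply: eq_egf2 (egf2D (Fg i) IH) _ _ => ? ?; rewrite big_cons.
Qed.

Lemma egf_delta j k : is_egf (fun n => if n == j then k else 0)
                             (fun x => (j`!%:R)^-1 * x ^+ j * k).
Proof.
exists j.+1; split=> [n lt_jn|x]; first by rewrite gtn_eqF.
rewrite big_ord_recr /= eqxx big1 ?add0r // => n _.
by rewrite ltn_eqF ?mulr0.
Qed.

(** By the binomial theorem the term [y^n/n!] of [(x + y)^j/j!] comes with [x^(j-n)/(j-n)!];
    multiplied by [x^s/s!] this is ['C(m, s) x^m/m!] for [m = s + j - n]. The test [s <= m] guards
    the truncated subtraction. *)
Lemma egf2_conv_delta s j :
  is_egf2 (fun m n => if (s <= m)%N && (m + n - s == j)%N then 'C(m, s)%:R else 0)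
          (fun x y => (s`!%:R)^-1 * x ^+ s * ((j`!%:R)^-1 * (x + y) ^+ j)).
Proof.
exists (fun n x => if (n <= j)%N then (s`!%:R)^-1 * x ^+ s * ((j - n)`!%:R^-1 * x ^+ (j - n)) else 0).
split=> [n|x].
  case: (leqP n j) => [le_nj|lt_jn]; last first.
    apply: eq_egf egf0 _ _ => // m; case: ifP => // /andP[le_sm /eqP]; lia.
  apply: eq_egf (egf_delta (s + j - n)%N 'C(s + j - n, s)%:R) _ _ => [m|x].
    have -> : ((s <= m) && (m + n - s == j))%N = (m == (s + j - n)%N) by lia.
    by case: eqP => [->|].
  have le_s : (s <= s + j - n)%N by lia.
  have := bin_fact le_s; have -> : (s + j - n - s = j - n)%N by lia.
  move/(congr1 (fun k => k%:R : K)); rewrite !natrM => binE.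
  have -> : x ^+ (s + j - n) = x ^+ s * x ^+ (j - n) by rewrite -exprD; congr (_ ^+ _); lia.
  rewrite -binE invfM; field; rewrite ?fact_neq0 ?andbT /=; last by apply: (natf_neq0_pchar0 hK); rewrite bin_gt0.
exists j.+1; split=> [n lt_jn|y]; first by rewrite leqNgt lt_jn.
rewrite exprDn 2!big_distrr; apply: eq_bigr => n _ /=.
have le_nj : (n <= j)%N by rewrite -ltnS.
rewrite le_nj -mulr_natl -(bin_fact le_nj) !natrM.
by field; rewrite !fact_neq0 ?natf_neq0_pchar0 ?bin_gt0.
Qed.

(* Turns the coefficientwise associativity axiom into [a_x (b_y c) = (a_x b)_(x+y) c]. *)
Lemma egf2_conv N (G : nat -> nat -> K) (h : nat -> K -> K) :
  (forall s, (N <= s)%N -> forall j, G s j = 0) ->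
  (forall s, is_egf (G s) (h s)) ->
  is_egf2 (fun m n => \sum_(s < m.+1) G s (m + n - s)%N *+ 'C(m, s))
          (fun x y => \sum_(s < N) (s`!%:R)^-1 * x ^+ s * h s (x + y)).
Proof.
move=> G0 Gh.
(* A common bound [J] for the finitely many sequences [G s], [s < N], lets every [h s] be expanded
   into monomials. *)
have [J GJ] : exists J, forall s, (s < N)%N -> (forall j, (J <= j)%N -> G s j = 0) /\
    forall x, h s x = \sum_(j < J) (j`!%:R)^-1 * x ^+ j * G s j.
  elim: (N) => [|n [J IH]]; first by exists 0%N.
  have [J' [GJ' hE]] := Gh n; exists (maxn J J') => s.
  rewrite ltnS leq_eqVlt => /orP[/eqP ->|/IH[G0' hE']]; split=> [j|x].
  - by rewrite geq_max => /andP[_ /GJ'].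
  - by rewrite hE (egf_widen _ (leq_maxr J J') GJ').
  - by rewrite geq_max => /andP[/G0'].
  - by rewrite hE' (egf_widen _ (leq_maxl J J') G0').
apply: eq_egf2 (egf2_sumr (index_enum 'I_N) (fun s : 'I_N =>
  egf2_sumr (index_enum 'I_J) (fun j : 'I_J => egf2Z (G s j) (egf2_conv_delta s j)))) _ _
  => [m n|x y] /=; last first.
  apply: eq_bigr => s _; rewrite (GJ s (ltn_ord s)).2 big_distrr; apply: eq_bigr => j _ /=.
  by ring.
have step (s : nat) : (s < N)%N -> \sum_(j < J) G s j *
    (if (s <= m)%N && (m + n - s == j)%N then 'C(m, s)%:R else 0)
    = if (s <= m)%N then G s (m + n - s)%N *+ 'C(m, s) else 0.
  move=> ltsN; case: (leqP s m) => [le_sm|_] /=; last by apply: big1 => j _; rewrite mulr0.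
  case: (ltnP (m + n - s) J) => [ltJ|leJ].
    rewrite (bigD1 (Ordinal ltJ)) //= eqxx mulr_natr big1 ?addr0 // => j /eqP neq.
    by case: eqP => [e|_]; rewrite ?mulr0 //; case: neq; apply: val_inj.
  rewrite (GJ s ltsN).1 // mul0rn big1 // => j _; case: eqP => [e|_]; last by rewrite mulr0.
  by move: (ltn_ord j); rewrite -e ltnNge leJ.
rewrite (eq_bigr _ (fun (s : 'I_N) _ => step s (ltn_ord s))).
pose T s := if (s <= m)%N then G s (m + n - s)%N *+ 'C(m, s) else 0.
(* The ranges [s < N] and [s < m.+1] are compared inside their maximum: [T s] vanishes outside
   either one. *)
transitivity (\sum_(s < maxn N m.+1) T s).
  rewrite (big_ord_widen _ T (leq_maxl N m.+1)) [RHS](bigID (fun s : 'I__ => (s < N)%N)) /=.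
  rewrite [X in _ = _ + X]big1 ?addr0 // => s; rewrite -leqNgt /T => le_Ns.
  by case: ifP => // _; rewrite G0 ?mul0rn.
rewrite (eq_bigr (fun s : 'I_m.+1 => T s)) => [|s _]; last by rewrite /T -ltnS ltn_ord.
rewrite (big_ord_widen _ T (leq_maxr N m.+1)) [LHS](bigID (fun s : 'I__ => (s < m.+1)%N)) /=.
rewrite [X in _ + X = _]big1 ?addr0 // => s; rewrite ltnS /T => le_ms.
by rewrite (negPf le_ms).
Qed.

End Egf.

(** * Square-zero extensions *)

Section PairProjections.
Variables (U V : zmodType).
Implicit Types X : U * V.

Lemma fst_mulrn X n : (X *+ n).1 = X.1 *+ n.
Proof. by elim: n => // n IH; rewrite !mulrSr -IH. Qed.

Lemma snd_mulrn X n : (X *+ n).2 = X.2 *+ n.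
Proof. by elim: n => // n IH; rewrite !mulrSr -IH. Qed.

Lemma fst_sumr n (F : 'I_n -> U * V) : (\sum_(i < n) F i).1 = \sum_(i < n) (F i).1.
Proof. exact: (big_morph fst). Qed.

Lemma snd_sumr n (F : 'I_n -> U * V) : (\sum_(i < n) F i).2 = \sum_(i < n) (F i).2.
Proof. exact: (big_morph snd). Qed.

End PairProjections.

Section SquareZero.
Variables (K : fieldType) (C : lmodType K) (S : confStr C).
Variables (A : lalgType K) (dA : A -> A).

(** The polynomial [q X Y] is the [A]-component of the [lambda]-product; the factor [n!] turns its
    coefficients into [n]-products. *)
Definition sqz (q : C * A -> C * A -> {poly A}) : confStr (C * A)%type :=
  @ConfStr K (C * A)%type
    (fun X => (cder S X.1, dA X.2))
    (fun n X Y => (cprod S n X.1 Y.1, (q X Y)`_n *+ n`!))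
    (fun X Y => maxn (cloc S X.1 Y.1) (size (q X Y))).

Hypothesis hK : [pchar K] =i pred0.
Hypothesis HS : is_assoc_conf S.
Variables (I : Type) (e : I -> {rmorphism A -> K}) (w : I -> K).
Hypothesis e_scale : forall i c a, e i (c *: a) = c * e i a.
Hypothesis e_sep : forall a b, (forall i, e i a = e i b) -> a = b.
Hypothesis e_der : forall i a, e i (dA a) = w i * e i a.
Variables (q : C * A -> C * A -> {poly A}) (g : I -> C * A -> C * A -> K -> K).
Hypothesis gE : forall i X Y x, (map_poly (e i) (q X Y)).[x] = g i X Y x.
Hypothesis g_linl : forall i c X X' Y x,
  g i (c *: X + X') Y x = c * g i X Y x + g i X' Y x.
Hypothesis g_linr : forall i c X Y Y' x,
  g i X (c *: Y + Y') x = c * g i X Y x + g i X Y' x.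
Hypothesis g_derl : forall i X Y x, g i (cder (sqz q) X) Y x = - (x * g i X Y x).
Hypothesis g_derr : forall i X Y x, g i X (cder (sqz q) Y) x = (w i + x) * g i X Y x.
Hypothesis g_assoc : forall i X Y Z, exists G : K -> K -> K,
  (forall x, is_egf (fun n => g i X (cprod (sqz q) n Y Z) x) (G x)) /\
  (forall x y, G x y = \sum_(s < cloc (sqz q) X Y)
     (s`!%:R)^-1 * x ^+ s * g i (cprod (sqz q) s X Y) Z (x + y)).

Lemma sqz_egf i X Y : is_egf (fun n => e i (cprod (sqz q) n X Y).2) (g i X Y).
Proof.
by apply: eq_egf (egf_poly hK (e i) (q X Y)) _ _ => // x; apply: gE.
Qed.

(** The evaluations [e i] separate the points of [A], and [egf_inj] separates [n]-products by their
    generating functions. Each axiom thus reduces to the matching hypothesis on [g]; in [g_assoc],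
    [G x y] is the value of [X_x (Y_y Z)]. *)
Lemma sqz_assoc_conf : is_assoc_conf (sqz q).
Proof.
have [S1 [S2 [S3 [S4 [S5 [S6 S7]]]]]] := HS.
have inj := egf_inj hK.
do 6?split.
- move=> c a b; congr (_, _); first exact: S1.
  apply: e_sep => i; rewrite e_der !rmorphD !e_scale !e_der /=; ring.
- move=> n c X X' Y; congr (_, _); first exact: S2.
  apply: e_sep => i; rewrite [RHS]rmorphD [X in _ = X + _]e_scale; move: n; apply: inj.
  + exact: sqz_egf.
  + exact: egfD (egfZ c (sqz_egf i X Y)) (sqz_egf i X' Y).
  + by move=> x; rewrite g_linl.
- move=> n c X Y Y'; congr (_, _); first exact: S3.
  apply: e_sep => i; rewrite [RHS]rmorphD [X in _ = X + _]e_scale; move: n; apply: inj.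
  + exact: sqz_egf.
  + exact: egfD (egfZ c (sqz_egf i X Y)) (sqz_egf i X Y').
  + by move=> x; rewrite g_linr.
- move=> X Y n /=; rewrite geq_max => /andP[/S4 -> le_n].
  by rewrite nth_default // mul0rn.
- move=> n X Y; apply: injective_projections.
    by rewrite [LHS]S5 -[RHS]/(- (_ *+ n).1) fst_mulrn.
  apply: e_sep => i; transitivity (-1 * (e i (cprod (sqz q) n.-1 X Y).2 *+ n)).
    move: n; apply: inj; first exact: sqz_egf.
      exact: egfZ (egf_shift hK (sqz_egf i X Y)).
    by move=> x; rewrite g_derl mulN1r.
  by rewrite mulN1r -rmorphMn -rmorphN -snd_mulrn.
- move=> n X Y; apply: injective_projections.
    by rewrite [LHS]S6 -[RHS]/(_ + (_ *+ n).1) fst_mulrn.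
  apply: e_sep => i.
  transitivity (w i * e i (cprod (sqz q) n X Y).2 + e i (cprod (sqz q) n.-1 X Y).2 *+ n).
    move: n; apply: inj; first exact: sqz_egf.
      exact: egfD (egfZ (w i) (sqz_egf i X Y)) (egf_shift hK (sqz_egf i X Y)).
    by move=> x; rewrite g_derr mulrDl.
  by rewrite -e_der -rmorphMn -rmorphD -snd_mulrn.
move=> m n X Y Z; apply: injective_projections.
  by rewrite fst_sumr [LHS]S7; apply: eq_bigr => s _; rewrite fst_mulrn.
apply: e_sep => i; rewrite snd_sumr rmorph_sum.
have [G [GF GE]] := g_assoc i X Y Z.
have eqs : is_egf2 (fun m n => e i (cprod (sqz q) m X (cprod (sqz q) n Y Z)).2) G.
  by exists (fun n => g i X (cprod (sqz q) n Y Z)); split=> [k|//]; apply: sqz_egf.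
have conv0 s : (cloc (sqz q) X Y <= s)%N -> forall j,
    e i (cprod (sqz q) j (cprod (sqz q) s X Y) Z).2 = 0.
  move=> le_s j; move: j; apply: (inj _ (fun=> 0) _ (fun=> 0)); first exact: sqz_egf.
    exact: egf0.
  move=> x; move: le_s; rewrite geq_max => /andP[/S4 /= -> /(nth_default 0) -> ].
  rewrite mul0rn; have := g_linl i (-1) 0 0 Z x; rewrite scaler0 addr0 => ->.
  by rewrite mulN1r addNr.
(* Both sides of associativity have [G] as bivariate generating function, hence equal
   coefficients. *)
have := egf2_conv hK conv0 (fun s => sqz_egf i (cprod (sqz q) s X Y) Z).
move=> /(egf2_inj hK eqs)/(_ GE) ->.
by apply: eq_bigr => s _; rewrite snd_mulrn; apply/esym/rmorphMn.
Qed.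

End SquareZero.

Lemma eq_point2 (K : fieldType) (a b c d : K) (p : {mpoly K[2]}) :
  a = c -> b = d -> p.@[point [:: a; b]] = p.@[point [:: c; d]].
Proof. by move=> -> ->. Qed.

Lemma eq_point3 (K : fieldType) (a b c a' b' c' : K) (p : {mpoly K[3]}) :
  a = a' -> b = b' -> c = c' -> p.@[point [:: a; b; c]] = p.@[point [:: a'; b'; c']].
Proof. by move=> -> -> ->. Qed.

Lemma meval_sumr (K : fieldType) n (v : 'I_n -> K) m (F : 'I_m -> {mpoly K[n]}) :
  (\sum_(i < m) F i).@[v] = \sum_(i < m) (F i).@[v].
Proof. exact: raddf_sum. Qed.

Lemma sum_widen0 (V : nmodType) N N' (F : nat -> V) : (N <= N')%N ->
  (forall s, (N <= s)%N -> F s = 0) -> \sum_(s < N') F s = \sum_(s < N) F s.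
Proof.
move=> leN F0; rewrite (big_ord_widen _ F leN).
rewrite [LHS](bigID (fun s : 'I_N' => (s < N)%N)) /= [X in _ + X]big1 ?addr0 // => s.
by rewrite -leqNgt => /F0.
Qed.

(** * Evaluation of substituted polynomials *)

Section Retraction.
Variables (K : fieldType) (B : nzRingType).
Variables (f : {rmorphism K -> B}) (theta : {rmorphism B -> K}).
Hypothesis fK : cancel f theta.

Lemma retract_mmap n (h : 'I_n -> B) (p : {mpoly K[n]}) :
  theta (mmap f h p) = p.@[fun i => theta (h i)].
Proof.
rewrite mevalE /mmap rmorph_sum; apply: eq_bigr => m _.
rewrite rmorphM /= fK rmorph_prod; congr (_ * _); apply: eq_bigr => i _.
exact: rmorphXn.
Qed.

Lemma retract_horner (l : {poly K}) (b : B) :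
  theta (map_poly f l).[b] = l.[theta b].
Proof.
rewrite !horner_coef size_map_poly rmorph_sum; apply: eq_bigr => i _.
by rewrite rmorphM rmorphXn coef_map /= fK.
Qed.

End Retraction.

(** * Module and cocycle identities at points *)

Section Values.
Variables (K : fieldType) (C : lmodType K) (S : confStr C).
Variables (rho : C -> {mpoly K[2]}).

Lemma conf_module_val (Hrho : is_conf_module S rho) a b x y z :
  (rho b).@[point [:: x + y; z]] * (rho a).@[point [:: x; y]] =
  \sum_(k < cloc S a b) (k`!%:R)^-1 * y ^+ k *
      (rho (cprod S k a b)).@[point [:: x; y + z]].
Proof.
have [_ _ /(_ a b) /(congr1 (meval (point [:: x; y; z])))] := Hrho.
rewrite mevalM !meval_comp2 meval_sumr /= !mevalD !meval_Xv !point_inord //= => ->.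
apply: eq_bigr => k _.
by rewrite mevalM meval_lamc meval_comp2 mevalD !meval_Xv !point_inord.
Qed.

(* The reduced cocycle condition, on the hyperplane [d + l1 + l2 + l3 = 0]. *)
Definition cocycle_val (phi : C -> C -> {mpoly K[3]}) : Prop := forall a b c d x y,
  (rho a).@[point [:: d; x]] * (phi b c).@[point [:: d + x; y; - (d + x + y)]]
  + \sum_(k < cloc S b c) (k`!%:R)^-1 * y ^+ k *
      (phi a (cprod S k b c)).@[point [:: d; x; - (d + x)]]
  = \sum_(k < cloc S a b) (k`!%:R)^-1 * x ^+ k *
      (phi (cprod S k a b) c).@[point [:: d; x + y; - (d + x + y)]].

Lemma red_cocycle2_val phi : red_cocycle2 S rho phi -> cocycle_val phi.
Proof.
move=> [_ [chi [_ hd]]] a b c d x y.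
(* At this point the factor [d + l1 + l2 + l3] of [del3 chi] vanishes. *)
pose P : 'I_4 -> K := point [:: d; x; y; - (d + x + y)].
have /(congr1 (meval P)) := hd a b c.
rewrite /hd2 /del3 mevalD mevalB !mevalM meval_comp2 meval_comp3 !meval_sumr /=.
have l1 (k : nat) : (lamc K 3 1 k * comp_mpoly [tuple Xv K 3 0; Xv K 3 1 + Xv K 3 2; Xv K 3 3]
    (phi (cprod S k a b) c)).@[P] = (k`!%:R)^-1 * x ^+ k *
      (phi (cprod S k a b) c).@[point [:: d; x + y; - (d + x + y)]].
  by rewrite mevalM meval_lamc meval_comp3 /= mevalD !meval_Xv /P !point_inord.
have l2 (k : nat) : (lamc K 3 2 k * comp_mpoly [tuple Xv K 3 0; Xv K 3 1; Xv K 3 2 + Xv K 3 3]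
    (phi a (cprod S k b c))).@[P] = (k`!%:R)^-1 * y ^+ k *
      (phi a (cprod S k b c)).@[point [:: d; x; - (d + x)]].
  rewrite mevalM meval_lamc meval_comp3 /= mevalD !meval_Xv /P !point_inord //=.
  by congr (_ * _); apply: eq_point3 => //; ring.
rewrite (eq_bigr _ (fun (k : 'I_(cloc S a b)) _ => l1 k)).
rewrite (eq_bigr _ (fun (k : 'I_(cloc S b c)) _ => l2 k)).
rewrite !mevalD !meval_Xv /P !point_inord //= [X in _ = X * _](_ : _ = 0); last by ring.
by rewrite mul0r => /eqP; rewrite addrAC subr_eq0 => /eqP.
Qed.

End Values.

(** * Polynomials in the formal parameter over an algebra *)

Section PolyEval.
Variables (K : fieldType) (A : lalgType K).

Definition subst_poly n (h : 'I_n -> {poly A}) (p : {mpoly K[n]}) : {poly A} :=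
  mmap (polyC \o in_alg A) h p.

Definition subst_poly1 (b : {poly A}) (l : {poly K}) : {poly A} :=
  (map_poly (polyC \o in_alg A) l).[b].

(* Defined over an abstract [A]: at [A := {mpoly K[2]}], unifying the ring structures of [{poly A}]
   is prohibitively slow. *)
Definition subst_poly2 n (h h' : 'I_n -> {poly A}) (p p' q q' : {mpoly K[n]}) : {poly A} :=
  subst_poly h p * subst_poly h' p' + subst_poly h q * subst_poly h' q'.

Variable e : {rmorphism A -> K}.

Definition poly_eval (x : K) : {rmorphism {poly A} -> K} := horner_eval x \o map_poly e.

Lemma poly_evalE x q : poly_eval x q = (map_poly e q).[x].
Proof. by []. Qed.

Hypothesis e_scale : forall c a, e (c *: a) = c * e a.

Lemma poly_evalK x : cancel (polyC \o in_alg A) (poly_eval x).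
Proof. by move=> c; rewrite poly_evalE /= map_polyC /= hornerC e_scale rmorph1 mulr1. Qed.

Lemma eval_subst x n (h : 'I_n -> {poly A}) p :
  (map_poly e (subst_poly h p)).[x] = p.@[fun i => (map_poly e (h i)).[x]].
Proof. exact: (retract_mmap (poly_evalK x)). Qed.

Lemma eval_subst1 x b l :
  (map_poly e (subst_poly1 b l)).[x] = l.[(map_poly e b).[x]].
Proof. exact: (retract_horner (poly_evalK x)). Qed.

Lemma eval_polyC x a : (map_poly e a%:P).[x] = e a.
Proof. by rewrite map_polyC hornerC. Qed.

Lemma eval_polyX x : (map_poly e 'X).[x] = x.
Proof. by rewrite map_polyX hornerX. Qed.

Lemma eval_polyD x p q : (map_poly e (p + q)).[x] = (map_poly e p).[x] + (map_poly e q).[x].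
Proof. by rewrite -!poly_evalE rmorphD. Qed.

Lemma eval_polyN x p : (map_poly e (- p)).[x] = - (map_poly e p).[x].
Proof. by rewrite -!poly_evalE rmorphN. Qed.

Lemma eval_polyM x p q : (map_poly e (p * q)).[x] = (map_poly e p).[x] * (map_poly e q).[x].
Proof. by rewrite -!poly_evalE rmorphM. Qed.

Lemma eval_subst2 x n (h h' : 'I_n -> {poly A}) p p' q q' :
  let t i := (map_poly e (h i)).[x] in let t' i := (map_poly e (h' i)).[x] in
  (map_poly e (subst_poly2 h h' p p' q q')).[x] = p.@[t] * p'.@[t'] + q.@[t] * q'.@[t'].
Proof. by rewrite eval_polyD !eval_polyM !eval_subst. Qed.

End PolyEval.

(** * Extensions by a module and by a bimodule of operators *)

Section Extensions.
Variables (K : fieldType) (C : lmodType K) (S : confStr C).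
Variables (rho : C -> {mpoly K[2]}).
Hypothesis hK : [pchar K] =i pred0.
Hypothesis HS : is_assoc_conf S.
Hypothesis Hrho : is_conf_module S rho.

Section ModuleExt.
Variable phi : C -> C -> {mpoly K[3]}.

(** The inner variable ['X%:P] is [d] and the outer ['X] is [l1]; the third argument of [phi] is
    [l2], eliminated by [d + l1 + l2 = 0]. *)
Definition modext_prod (X Y : C * {poly K}) : {poly {poly K}} :=
  subst_poly (tnth [tuple 'X%:P; 'X; - ('X%:P + 'X)]) (phi X.1 Y.1)
  + subst_poly (tnth [tuple 'X%:P; 'X]) (rho X.1) * subst_poly1 ('X%:P + 'X) Y.2.

(* [C + K[d]u] with [a_l (b) = a_l b + phi_l(a, b)] and the right action of [C] on [K[d]u] zero. *)
Definition modext : confStr (C * {poly K})%type :=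
  sqz S (fun m => 'X * m) modext_prod.

Definition modext_val (d : K) (X Y : C * {poly K}) (x : K) : K :=
  (phi X.1 Y.1).@[point [:: d; x; - (d + x)]]
  + (rho X.1).@[point [:: d; x]] * Y.2.[d + x].

Lemma modext_valE d X Y x :
  (map_poly (horner_eval d) (modext_prod X Y)).[x] = modext_val d X Y x.
Proof.
have sc c (a : {poly K}) : horner_eval d (c *: a) = c * horner_eval d a.
  by rewrite /horner_eval hornerZ.
rewrite eval_polyD eval_polyM !eval_subst // eval_subst1 // eval_polyD eval_polyC eval_polyX.
congr (_ + _ * _); last by rewrite /= /horner_eval hornerX.
all: apply: meval_eq => i; rewrite (tnth_nth 0) /point.
  by case: i => [[|[|[|i]]]] //= _;
    rewrite ?eval_polyN ?eval_polyD ?eval_polyC ?eval_polyX /= /horner_eval ?hornerX.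
by case: i => [[|[|i]]] //= _; rewrite ?eval_polyC ?eval_polyX /= /horner_eval ?hornerX.
Qed.

(** As the right action is zero, associativity splits into a part in [phi], which is the cocycle
    identity, and a part linear in the module component of the last factor, which is the module
    axiom. *)
Lemma modext_assoc : cochain2 S phi -> cocycle_val S rho phi -> is_assoc_conf modext.
Proof.
move=> [phi1 phi2 phi3 phi4] cocyc.
have [rho1 rho2 _] := Hrho.
have rhoM := conf_module_val Hrho.
have [_ [_ [_ [S4 _]]]] := HS.
apply: (sqz_assoc_conf hK HS (e := fun d => horner_eval d) (w := id) _ _ _ modext_valE).
- by move=> d c a; apply: hornerZ.
- by move=> a b; apply: poly_ext.
- by move=> d a; rewrite /= -[LHS]/(('X * a).[d]) hornerM hornerX.
- move=> d c X X' Y x; rewrite /modext_val /= phi1 rho1 !mevalD !mevalZ; ring.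
- move=> d c X Y Y' x; rewrite /modext_val /= phi2 mevalD mevalZ hornerD hornerZ; ring.
- move=> d X Y x; rewrite /modext_val /= phi3 rho2 !mevalN !mevalM !meval_Xv !point_inord //=.
  ring.
- move=> d X Y x; rewrite /modext_val /= phi4 !mevalN !mevalM !meval_Xv !point_inord //=.
  rewrite hornerM hornerX; ring.
move=> d [a k] [b l] [c m].
(* The sum is [phi_x(a, b_y c)]; the other term is [a_x] applied to the module component of
   [(b, l)_y (c, m)], hence the shift to [d + x]. *)
exists (fun x y => \sum_(n < cloc S b c) (n`!%:R)^-1 * y ^+ n *
     (phi a (cprod S n b c)).@[point [:: d; x; - (d + x)]]
   + (rho a).@[point [:: d; x]] * modext_val (d + x) (b, l) (c, m) y); split=> [x|x y].
  apply: egfD; last first.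
    apply: egfZ; apply: eq_egf (egf_poly hK (horner_eval (d + x)) (modext_prod (b, l) (c, m))) _ _
      => // y; exact: modext_valE.
  apply: egf_bounded => n /S4 /= ->.
  have := phi2 (-1) a 0 0; rewrite scaler0 addr0 scaleN1r addNr => ->.
  by rewrite meval0.
rewrite /modext_val /= mulrDr addrA [X in X + _ = _]addrC cocyc mulrA.
rewrite [in RHS](eq_bigr _ (fun s _ => mulrDr _ _ _)) big_split /=; congr (_ + _).
  rewrite (sum_widen0 (leq_maxl (cloc S a b) _)
    (F := fun s => (s`!%:R)^-1 * x ^+ s *
     (phi (cprod S s a b) c).@[point [:: d; x + y; - (d + (x + y))]])).
    by apply: eq_bigr => s _; rewrite addrA.
  move=> s /S4 ->; have := phi1 (-1) 0 0 c; rewrite scaler0 addr0 scaleN1r addNr => ->.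
  by rewrite meval0 mulr0.
rewrite (mulrC (rho a).@[_]) rhoM mulr_suml.
rewrite -(sum_widen0 (leq_maxl (cloc S a b) (size (modext_prod (a, k) (b, l))))
    (F := fun s => (s`!%:R)^-1 * x ^+ s *
     (rho (cprod S s a b)).@[point [:: d; x + y]] * m.[d + x + y])) => [|s /S4 ->].
  by apply: eq_bigr => s _; rewrite addrA mulrA.
have := rho1 (-1) 0 0; rewrite scaler0 addr0 scaleN1r addNr => ->.
by rewrite meval0 mulr0 mul0r.
Qed.

End ModuleExt.

Definition bimodext_prod (X Y : C * {mpoly K[2]}) : {poly {mpoly K[2]}} :=
  let t := [tuple (Xv K 1 0)%:P; 'X] in
  let t' := [tuple (Xv K 1 0)%:P + 'X; (Xv K 1 1)%:P - 'X] in
  subst_poly2 (tnth t) (tnth t') (rho X.1) Y.2 X.2 (rho Y.1).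

(* The split extension of [C] by the bimodule [Cend(K[d]u) = K[d,l]]: [k(d,l)] stands for the
   operator [k_l u = k(d,l) u], so that [(a_x k)_n u = a_x (k_(n-x) u)]. *)
Definition bimodext : confStr (C * {mpoly K[2]})%type :=
  sqz S (fun k => - (Xv K 1 1 * k)) bimodext_prod.

Definition bimodext_val (v : 'I_2 -> K) (X Y : C * {mpoly K[2]}) (x : K) : K :=
  let t := point [:: v (inord 0); x] in
  let t' := point [:: v (inord 0) + x; v (inord 1) - x] in
  (rho X.1).@[t] * Y.2.@[t'] + X.2.@[t] * (rho Y.1).@[t'].

Lemma bimodext_valE v X Y x :
  (map_poly (meval v) (bimodext_prod X Y)).[x] = bimodext_val v X Y x.
Proof.
have tC k : (map_poly (meval v) (Xv K 1 k)%:P).[x] = v (inord k).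
  by rewrite eval_polyC; apply: meval_Xv.
have t0 (p : {mpoly K[2]}) : p.@[fun i => (map_poly (meval v)
    (tnth [tuple (Xv K 1 0)%:P; 'X] i)).[x]] = p.@[point [:: v (inord 0); x]].
  apply: meval_eq => i; rewrite (tnth_nth 0) /point.
  by case: i => [[|[|i]]] //= _; rewrite ?tC ?eval_polyX.
have t1 (p : {mpoly K[2]}) : p.@[fun i => (map_poly (meval v)
    (tnth [tuple (Xv K 1 0)%:P + 'X; (Xv K 1 1)%:P - 'X] i)).[x]]
    = p.@[point [:: v (inord 0) + x; v (inord 1) - x]].
  apply: meval_eq => i; rewrite (tnth_nth 0) /point.
  by case: i => [[|[|i]]] //= _;
    rewrite eval_polyD ?eval_polyN tC eval_polyX.
rewrite [LHS](eval_subst2 (mevalZ v)).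
by rewrite !t0 !t1.
Qed.

(** Operators compose associatively: the terms in [m] agree by the module axiom for [a, b], those in
    [k] by the one for [b, c], and those in [l] directly. *)
Lemma bimodext_assoc : is_assoc_conf bimodext.
Proof.
have [rho1 rho2 _] := Hrho.
have rhoM := conf_module_val Hrho.
have [_ [_ [_ [S4 _]]]] := HS.
have rho0 : rho 0 = 0.
  by have := rho1 (-1) 0 0; rewrite scaler0 addr0 scaleN1r addNr.
have rho0_sum a b N x y z : (cloc S a b <= N)%N ->
    (rho b).@[point [:: x + y; z]] * (rho a).@[point [:: x; y]] =
    \sum_(k < N) (k`!%:R)^-1 * y ^+ k * (rho (cprod S k a b)).@[point [:: x; y + z]].
  move=> le_N; rewrite rhoM (sum_widen0 le_N (F := fun k => (k`!%:R)^-1 * y ^+ k *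
    (rho (cprod S k a b)).@[point [:: x; y + z]])) // => s /S4 ->.
  by rewrite rho0 meval0 mulr0.
apply: (sqz_assoc_conf hK HS (e := fun v => meval v) (w := fun v => - v (inord 1)) _ _ _ bimodext_valE).
- by move=> v c a; apply: mevalZ.
- by move=> a b; apply: mpoly_ext.
- by move=> v a; rewrite /= mevalN mevalM meval_Xv mulNr.
- move=> v c X X' Y x; rewrite /bimodext_val /= rho1 !mevalD !mevalZ; ring.
- move=> v c X Y Y' x; rewrite /bimodext_val /= rho1 !mevalD !mevalZ; ring.
- move=> v X Y x; rewrite /bimodext_val /= rho2 !mevalN !mevalM !meval_Xv !point_inord //=.
  ring.
- move=> v X Y x; rewrite /bimodext_val /= rho2 !mevalN !mevalM !meval_Xv !point_inord //=.
  ring.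
move=> v [a k] [b l] [c m]; set d := v (inord 0); set nu := v (inord 1).
exists (fun x y => (rho a).@[point [:: d; x]] *
     bimodext_val (point [:: d + x; nu - x]) (b, l) (c, m) y
   + k.@[point [:: d; x]] * ((rho c).@[point [:: d + x + y; nu - x - y]] *
       (rho b).@[point [:: d + x; y]])); split=> [x|x y].
  rewrite /bimodext_val /=; apply: egfD; apply: egfZ.
    apply: eq_egf (egf_poly hK (meval (point [:: d + x; nu - x])) (bimodext_prod (b, l) (c, m))) _ _
      => // y; exact: bimodext_valE.
  apply: eq_egf (egf_bounded (N := cloc S b c) (c := fun n => (rho (cprod S n b c)).@[
      point [:: d + x; nu - x]]) _) _ _ => // [n /S4 ->|y]; first by rewrite rho0 meval0.
  rewrite (rho0_sum b c _ _ _ _ (leqnn _)).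
  by apply: eq_bigr => n _; congr (_ * _); apply: eq_point2 => //; ring.
rewrite {2}/bimodext_val /=.
rewrite [in RHS](eq_bigr _ (fun s _ => mulrDr _ _ _)) big_split /=.
set N := maxn _ _.
have -> : \sum_(s < N) (s`!%:R)^-1 * x ^+ s * ((rho (cprod S s a b)).@[point [:: d; x + y]] *
      m.@[point [:: d + (x + y); nu - (x + y)]]) =
    (rho b).@[point [:: d + x; y]] * (rho a).@[point [:: d; x]] *
      m.@[point [:: d + (x + y); nu - (x + y)]].
  rewrite (rho0_sum a b N) ?leq_maxl // mulr_suml.
  by apply: eq_bigr => s _; rewrite mulrA.
have -> : \sum_(s < N) (s`!%:R)^-1 * x ^+ s *
     (((bimodext_prod (a, k) (b, l))`_s *+ s`!).@[point [:: d; x + y]] *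
      (rho c).@[point [:: d + (x + y); nu - (x + y)]]) =
    bimodext_val (point [:: d; x + y]) (a, k) (b, l) x *
      (rho c).@[point [:: d + (x + y); nu - (x + y)]].
  rewrite -bimodext_valE (horner_egf hK _ _ (leq_maxr _ _ : (_ <= N)%N)) mulr_suml.
  by apply: eq_bigr => s _; rewrite mulrA.
rewrite /bimodext_val /= !point_inord //=.
rewrite !(eq_point2 _ (_ : d + x + y = d + (x + y)) (_ : nu - x - y = nu - (x + y))); try ring.
rewrite !(eq_point2 _ (erefl (d + x)) (_ : x + y - x = y)); try ring.
Qed.

End Extensions.

Lemma egf_quadratic (K : fieldType) (hK : [pchar K] =i pred0) (c : nat -> K) g a0 a1 a2 :
  is_egf c g -> (forall x, g x = a0 + a1 * x + a2 * x ^+ 2) ->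
  [/\ c 0%N = a0, c 1%N = a1, c 2%N = a2 *+ 2 & forall n, (3 <= n)%N -> c n = 0].
Proof.
move=> cg gE.
have two : (2%:R : K) != 0 by apply: natf_neq0_pchar0.
pose c' n : K := nth 0 [:: a0; a1; a2 *+ 2] n.
have ec : c =1 c'.
  apply: (egf_inj hK cg (egf_bounded (N := 3) (c := c') _)) => [n le3|x].
    by rewrite /c' nth_default.
  rewrite gE 3!big_ord_recr big_ord0 /= (_ : 2`! = 2%N) // (_ : 1`! = 1%N) // fact0 /c' /=.
  by field; rewrite two oner_neq0.
by split=> [|||n le3]; rewrite ec // /c' nth_default.
Qed.

(** * Consequences of the universal property *)

Section U3.
Variables (K : fieldType) (C : lmodType K) (S : confStr C) (v : C).
Hypothesis hK : [pchar K] =i pred0.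
Hypothesis HU : is_U3 S v.

(** The universal property maps [v] to [(v, k)]. The first component of this morphism is an
    endomorphism of [C] fixing [v], hence the identity by uniqueness, so the second component is the
    required map. *)
Lemma U3_section (A : lalgType K) (dA : A -> A) (q : C * A -> C * A -> {poly A}) (k : A) :
  is_assoc_conf (sqz S dA q) -> U3_rel (sqz S dA q) (v, k) ->
  exists f : C -> A,
    [/\ forall (c : K) a b, f (c *: a + b) = c *: f a + f b,
        forall a, f (cder S a) = dA (f a),
        forall n a b, f (cprod S n a b) = (q (a, f a) (b, f b))`_n *+ n`!
      & f v = k].
Proof.
move=> TA TU; have [SA SU init] := HU.
have [F [[F1 F2 F3] Fv _]] := init _ _ _ TA TU.
have [G [_ _ Guniq]] := init _ _ _ SA SU.
have Ffst a : (F a).1 = a.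
  rewrite (Guniq (fun a => (F a).1)) ?Fv //; last first.
    by split=> [c x y|x|n x y]; rewrite ?F1 ?F2 ?F3.
  by rewrite -(Guniq id).
have FE a : F a = (a, (F a).2) by rewrite -{2}(Ffst a); case: (F a).
exists (fun a => (F a).2); split=> [c a b|a|n a b|]; rewrite ?F1 ?F2 ?F3 ?Fv //=.
by rewrite -!FE.
Qed.

Variable (Delta : K) (rho : C -> {mpoly K[2]}).
Hypothesis Hrho : is_conf_module S rho.
Hypothesis Hv : rho v = Xv K 1 0 + Delta *: Xv K 1 1.

Lemma rho_v x y : (rho v).@[point [:: x; y]] = x + Delta * y.
Proof. by rewrite Hv mevalD mevalZ !meval_Xv !point_inord. Qed.

Lemma U3_rel_sqz (A : lalgType K) (dA : A -> A) (q : C * A -> C * A -> {poly A}) (k : A) :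
  (forall n, (3 <= n)%N -> (q (v, k) (v, k))`_n *+ n`! = 0) ->
  ((q (v, k) (v, k))`_1 *+ 1`!) *+ 2 - dA ((q (v, k) (v, k))`_2 *+ 2`!) = k *+ 2 ->
  U3_rel (sqz S dA q) (v, k).
Proof.
have [_ [U1 U2] _] := HU => q0 q1; split=> [n le3|].
  by congr (_, _); [apply: U1 | apply: q0].
by congr (_, _); [apply: U2 | apply: q1].
Qed.

Let HS : is_assoc_conf S. Proof. by have [] := HU. Qed.

Let S4 a b n : (cloc S a b <= n)%N -> cprod S n a b = 0.
Proof. by have [_ [_ [_ [S4 _]]]] := HS; apply: S4. Qed.

(** A lift of [v] satisfying the relations yields a section of the extension, whose second component
    is [psi]. Its compatibility with products writes [phi] as [psi(a_x b) - a_x psi(b)] on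
    [d + l1 + l2 = 0]. *)
Lemma modext_split phi k :
  cochain2 S phi -> cocycle_val S rho phi -> U3_rel (modext S rho phi) (v, k) ->
  exists psi : C -> {poly K},
    [/\ forall (c : K) a b, psi (c *: a + b) = c *: psi a + psi b,
        forall a, psi (cder S a) = 'X * psi a,
        psi v = k
      & forall a b d x, \sum_(k < cloc S a b) (k`!%:R)^-1 * x ^+ k * (psi (cprod S k a b)).[d]
          = (phi a b).@[point [:: d; x; - (d + x)]]
            + (rho a).@[point [:: d; x]] * (psi b).[d + x]].
Proof.
move=> Hphi cocyc rel.
have [psi [psi1 psi2 psi3 psiv]] := U3_section (modext_assoc hK HS Hrho Hphi cocyc) rel.
exists psi; split=> // a b d x.
have psi0 : psi 0 = 0.
  by have := psi1 (-1) 0 0; rewrite scaler0 addr0 scaleN1r addNr.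
rewrite -[RHS](modext_valE rho phi d (a, psi a) (b, psi b)).
rewrite (horner_egf hK _ _ (leq_maxr (cloc S a b) _)).
rewrite -(sum_widen0 (leq_maxl (cloc S a b) (size (modext_prod rho phi (a, psi a) (b, psi b))))
   (F := fun k => (k`!%:R)^-1 * x ^+ k * (psi (cprod S k a b)).[d])) => [|s /S4 ->].
  by apply: eq_bigr => s _; rewrite psi3.
by rewrite psi0 horner0 mulr0.
Qed.

(* The derivative in [Delta] of the family of modules [M_(0,Delta)]. *)
Lemma module_deformation : exists rho' : C -> {mpoly K[2]},
  [/\ forall (c : K) a b, rho' (c *: a + b) = c *: rho' a + rho' b,
      forall a, rho' (cder S a) = - (Xv K 1 1 * rho' a),
      rho' v = Xv K 1 1
    & forall a b d x y, \sum_(k < cloc S a b) (k`!%:R)^-1 * x ^+ k *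
          (rho' (cprod S k a b)).@[point [:: d; y]]
        = (rho a).@[point [:: d; x]] * (rho' b).@[point [:: d + x; y - x]]
          + (rho' a).@[point [:: d; x]] * (rho b).@[point [:: d + x; y - x]]].
Proof.
(* The element [Xv K 1 1] is the derivative of [d + Delta l] in [Delta]. The product below is
   quadratic in [x], and the second relation reads [2 (2 Delta l) + l * 2 (1 - 2 Delta) = 2 l]. *)
have rel : U3_rel (bimodext S rho) (v, Xv K 1 1).
  have coefs (t : 'I_2 -> K) := @egf_quadratic K hK _ _
    (t (inord 0) * t (inord 1)) (Delta * t (inord 1) *+ 2) (1 - Delta *+ 2)
    (egf_poly hK (meval t) (bimodext_prod rho (v, Xv K 1 1) (v, Xv K 1 1))) _.
  have val t x : (map_poly (meval t) (bimodext_prod rho (v, Xv K 1 1) (v, Xv K 1 1))).[x]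
      = t (inord 0) * t (inord 1) + Delta * t (inord 1) *+ 2 * x + (1 - Delta *+ 2) * x ^+ 2.
    rewrite bimodext_valE /bimodext_val !rho_v !meval_Xv !point_inord //=; ring.
  apply: U3_rel_sqz => [n le3|].
    by apply: (mpoly_ext hK) => t; have [_ _ _ ->] := coefs val t; rewrite ?meval0.
  apply: (mpoly_ext hK) => t; have [_ c1 c2 _] := coefs val t.
  rewrite opprK mevalD mevalM mevalMn c1 c2 mevalMn !meval_Xv; ring.
have [f [f1 f2 f3 fv]] := U3_section (bimodext_assoc hK HS Hrho) rel.
exists f; split=> // a b d x y.
have f0 : f 0 = 0 by have := f1 (-1) 0 0; rewrite scaler0 addr0 scaleN1r addNr.
have := bimodext_valE rho (point [:: d; y]) (a, f a) (b, f b) x.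
rewrite /bimodext_val !point_inord //= => <-.
rewrite (horner_egf hK _ _ (leq_maxr (cloc S a b) _)).
rewrite -(sum_widen0 (leq_maxl (cloc S a b) (size (bimodext_prod rho (a, f a) (b, f b))))
   (F := fun k => (k`!%:R)^-1 * x ^+ k * (f (cprod S k a b)).@[point [:: d; y]])) => [|s /S4 ->].
  by apply: eq_bigr => s _; rewrite f3.
by rewrite f0 meval0 mulr0.
Qed.

(* For [Delta = 1] the element [v + u] of the split extension satisfies the relations of [U(3)]. *)
Lemma module_derivation : Delta = 1 -> exists psi : C -> {poly K},
  [/\ forall (c : K) a b, psi (c *: a + b) = c *: psi a + psi b,
      forall a, psi (cder S a) = 'X * psi a,
      psi v = 1
    & forall a b d x, \sum_(k < cloc S a b) (k`!%:R)^-1 * x ^+ k * (psi (cprod S k a b)).[d]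
        = (rho a).@[point [:: d; x]] * (psi b).[d + x]].
Proof.
move=> Delta1; pose phi0 (a b : C) : {mpoly K[3]} := 0.
have cochain0 : cochain2 S phi0.
  by split=> *; rewrite /phi0 ?scaler0 ?addr0 ?mulr0 ?oppr0.
have cocycle0 : cocycle_val S rho phi0.
  by move=> a b c d x y; rewrite meval0 mulr0 !big1 ?addr0 // => k _; rewrite meval0 mulr0.
(* The module component of the product is [d + x], so its first product is [1] and its higher ones
   vanish; the second relation is then [2 * 1 - 0 = 2 * 1]. *)
have rel : U3_rel (modext S rho phi0) (v, 1).
  have coefs (d : K) := @egf_quadratic K hK _ _ d 1 0
    (egf_poly hK (horner_eval d) (modext_prod rho phi0 (v, 1) (v, 1))) _.
  have val d x : (map_poly (horner_eval d) (modext_prod rho phi0 (v, 1) (v, 1))).[x]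
      = d + 1 * x + 0 * x ^+ 2.
    rewrite modext_valE /modext_val rho_v Delta1 meval0 /= hornerC; ring.
  have coefs' := coefs val.
  apply: U3_rel_sqz => [n le3|]; apply: (poly_ext hK) => d.
    by have [_ _ _ /(_ n le3)] := coefs' d; rewrite /= /horner_eval horner0.
  have [_ + + _] := coefs' d; rewrite /= /horner_eval => c1 c2.
  by rewrite hornerD hornerN hornerM c2 hornerMn c1 hornerMn hornerC mul0rn mulr0 subr0.
have [psi [p1 p2 p3 p4]] := modext_split cochain0 cocycle0 rel.
by exists psi; split=> // a b d x; rewrite p4 meval0 add0r.
Qed.

End U3.

Lemma egf_fun_inj (K : fieldType) (c c' : nat -> K) g g' :
  is_egf c g -> is_egf c' g' -> c =1 c' -> g =1 g'.
Proof.
move=> [N [c0 gE]] [N' [c'0 g'E]] ec x; rewrite gE g'E.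
rewrite (egf_widen _ (leq_maxl N N') c0) (egf_widen _ (leq_maxr N N') c'0).
by apply: eq_bigr => n _; rewrite ec.
Qed.

Lemma poly_split0 (K : fieldType) (p : {poly K}) : exists r, p = r * 'X + (p.[0])%:P.
Proof.
elim/poly_ind: p => [|p c _]; first by exists 0; rewrite horner0 mul0r add0r.
by exists p; rewrite hornerD hornerM hornerX mulr0 add0r hornerC.
Qed.

(** * Triple products of a lift of the generator *)

(* [V] is a lift of the generator of [U(3)] to a square-zero extension; [p n] for [n >= 3] and [rr]
   measure the failure of its defining relations, and [br] is the value at [d = 0]. *)
Section TripleProducts.
Variables (K : fieldType) (E : lmodType K) (T : confStr E) (V rr : E).
Hypothesis hK : [pchar K] =i pred0.
Hypothesis HT : is_assoc_conf T.
Let p n := cprod T n V V.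
Hypothesis p_ann : forall n k, (3 <= n)%N -> cprod T k (p n) V = 0.
Hypothesis rr_ann : forall k, cprod T k rr V = 0.
Hypothesis p1E : p 1 + p 1 = cder T (p 2) + (V + V) + rr.
Variable br : {additive E -> K}.
Hypothesis br_der : forall X, br (cder T X) = 0.
Hypothesis br_p : forall n, (0 < n)%N -> br (p n) = 0.
Hypothesis br_v0 : forall n, (3 <= n)%N -> br (cprod T 0 V (p n)) = 0.
Hypothesis br_v1 : forall n, (3 <= n)%N -> br (cprod T 1 V (p n)) = 0.

Lemma conf_addl n X Y Z : cprod T n (X + Y) Z = cprod T n X Z + cprod T n Y Z.
Proof. by have [_ [+ _]] := HT => /(_ n 1 X Y Z); rewrite !scale1r. Qed.

Lemma conf_addr n X Y Z : cprod T n Z (X + Y) = cprod T n Z X + cprod T n Z Y.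
Proof. by have [_ [_ [+ _]]] := HT => /(_ n 1 Z X Y); rewrite !scale1r. Qed.

Let alpha k := br (cprod T k (p 0) V).
Let delta k := br (cprod T k (p 2) V).
Let theta k := br (cprod T k (p 1) V).

(** Take the [k]-th product of [p1E] with [V] on the right: [rr] is annihilated, [V (k) V] has [br]
    zero, and the derivative of [p 2] contributes [- k (p 2 (k-1) V)]. *)
Let thetaE k : (0 < k)%N -> theta k *+ 2 = - (delta k.-1 *+ k).
Proof.
move=> k_gt0; have [_ [_ [_ [_ [T5 _]]]]] := HT.
have e : cprod T k (p 1) V + cprod T k (p 1) V =
    - (cprod T k.-1 (p 2) V *+ k) + (p k + p k).
  by rewrite -conf_addl p1E !conf_addl rr_ann addr0 T5.
by rewrite mulr2n -raddfD e !raddfD raddfN raddfMn br_p // addr0 addr0.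
Qed.

(** In the associativity sum the terms with [s >= 3] die by [p_ann]; those with [s = 0, 1, 2]
    remain. *)
Let tauE m n : br (cprod T m V (p n)) =
  alpha (m + n) + theta (m + n).-1 *+ m + delta (m + n).-2 *+ 'C(m, 2).
Proof.
have [_ [_ [_ [_ [_ [_ T7]]]]]] := HT.
rewrite T7 raddf_sum.
pose F s := br (cprod T (m + n - s) (p s) V *+ 'C(m, s)).
have F0 s : (3 <= s)%N -> F s = 0.
  by move=> le3; rewrite /F (p_ann _ le3) mul0rn raddf0.
transitivity (\sum_(s < 3) F s); last first.
  have -> : \sum_(s < 3) F s = F 0%N + F 1%N + F 2%N.
    by rewrite 3!big_ord_recr big_ord0 /= add0r.  
  by rewrite /F /= !raddfMn subn0 subn1 subn2 bin0 bin1.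
rewrite -(sum_widen0 (leq_maxl 3 m.+1) F0); apply/esym.
apply: (sum_widen0 (leq_maxr 3 m.+1)) => s lt_ms.
by rewrite /F bin_small // mulr0n raddf0.
Qed.

Let two : (2%:R : K) != 0. Proof. exact: natf_neq0_pchar0. Qed.

Let bin2E m : 'C(m, 2)%:R *+ 2 = (m%:R * (m%:R - 1) : K).
Proof.
case: m => [|m]; first by rewrite bin0n mul0rn mul0r.
have -> : m.+1%:R - 1 = m%:R :> K by rewrite -natr1 addrK.
by rewrite -natrM -mulrnA muln2 bin2 halfK oddM /= andNb subn0.
Qed.

(** Doubling allows [theta] to be eliminated by [thetaE]; the last factor equals [- m n]. *)
Let tau2E m n : (0 < (m + n).-1)%N -> br (cprod T m V (p n)) *+ 2 =
  alpha (m + n) *+ 2 + delta (m + n).-2 * (m%:R * (m%:R - 1 - (m + n).-1%:R)).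
Proof.
move=> mn_gt0; rewrite tauE !mulrnDl -[_ *+ m *+ 2]mulrnA mulnC mulrnA thetaE //.
rewrite -[_ *+ 'C(m, 2)]mulr_natr -mulrnAr bin2E.
by rewrite -[_ *+ m]mulr_natr -[_ *+ (m + n).-1]mulr_natr; ring.
Qed.

Let alpha0 n : (3 <= n)%N -> alpha n = 0.
Proof.
move=> le3; have := tauE 0 n; rewrite br_v0 // add0n mulr0n bin0n /= mulr0n !addr0.
by move<-.
Qed.

Let delta0 n : (2 <= n)%N -> delta n = 0.
Proof.
move=> le2; have := @tau2E 1 n.+1 isT.
rewrite br_v1 // alpha0; last by lia.
rewrite mul0rn add0r mul1r subrr sub0r /= => /eqP.
by rewrite eq_sym mulf_eq0 oppr_eq0 (negPf (natf_neq0_pchar0 hK _)) // orbF => /eqP.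
Qed.

(* With [delta k = br (p 2 (k) V)], evaluating [V (m) (V (n) V)] by associativity gives
   [- (m n / 2) delta (m + n - 2)] for [n >= 3]; the case [m = 1] kills [delta k] for [k >= 2]. *)
Lemma triple_ge3 m n : (3 <= n)%N -> br (cprod T m V (p n)) = 0.
Proof.
move=> le3; case: m => [|m]; first exact: br_v0.
apply/eqP; rewrite -(mulIr_eq0 _ (mulIf two)) mulr_natr; apply/eqP.
by rewrite tau2E ?alpha0 ?delta0 ?mul0rn ?mul0r ?addr0 //; lia.
Qed.

(** Apply [V (m)] to [p1E], double, and expand by [tau2E]: twice the value is
    [2 m (m - 2) delta (m - 1)]. The factor vanishes for [m = 2], and [delta (m - 1)] does for
    [m >= 3]. *)
Lemma triple_rr m : (2 <= m)%N -> br (cprod T m V rr) = 0.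
Proof.
move=> le2; have [_ [_ [_ [_ [_ [T6 _]]]]]] := HT.
have := congr1 (fun X => br (cprod T m V X)) p1E.
rewrite !conf_addr T6 !raddfD raddfMn br_der br_p ?(leq_trans _ le2) // !addr0 add0r -mulr2n.
rewrite tau2E ?addn1 //; last by case: m le2.
rewrite /= alpha0 // mul0rn add0r => /esym/eqP.
rewrite addrC eq_sym -subr_eq => /eqP e.
apply/eqP; rewrite -(mulIr_eq0 _ (mulIf two)) mulr_natr -e mulrnBl -[_ *+ m *+ 2]mulrnA.
rewrite mulnC mulrnA tau2E; last by lia.
have -> : (m.-1 + 2 = m.+1)%N by lia.
have -> : m.-1%:R = m%:R - 1 :> K by rewrite -subn1 natrB // (leq_trans _ le2).
rewrite alpha0 // mul0rn add0r /= -[_ *+ m]mulr_natr.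
have [->|ne2] := eqVneq m 2%N; first by apply/eqP; ring.
by rewrite delta0 ?mul0r ?mul0rn ?subrr //; lia.
Qed.

End TripleProducts.

(** * Correcting the lift of the generator *)

Section Obstruction.
Variables (K : fieldType) (C : lmodType K) (S : confStr C) (v : C).
Hypothesis hK : [pchar K] =i pred0.
Hypothesis HU : is_U3 S v.
Variable (Delta : K) (rho : C -> {mpoly K[2]}).
Hypothesis hDelta : Delta != 0.
Hypothesis Hrho : is_conf_module S rho.
Hypothesis Hv : rho v = Xv K 1 0 + Delta *: Xv K 1 1.
Variable phi : C -> C -> {mpoly K[3]}.
Hypothesis Hphi : cochain2 S phi.
Hypothesis cocyc : cocycle_val S rho phi.

Let HS : is_assoc_conf S. Proof. by have [] := HU. Qed.
Let T := modext S rho phi.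
Let HT : is_assoc_conf T. Proof. exact: modext_assoc. Qed.

Implicit Types X Y : (C * {poly K})%type.

Definition snd_at0 X : K := X.2.[0].

Fact snd_at0_is_zmod_morphism : zmod_morphism snd_at0.
Proof. by move=> X Y; rewrite /snd_at0 /= hornerD hornerN. Qed.

HB.instance Definition _ := GRing.isZmodMorphism.Build (C * {poly K})%type K snd_at0
  snd_at0_is_zmod_morphism.

Lemma modext_egf d X Y : is_egf (fun n => (cprod T n X Y).2.[d]) (modext_val rho phi d X Y).
Proof.
by apply: eq_egf (egf_poly hK (horner_eval d) (modext_prod rho phi X Y)) _ _ => // x;
  apply: modext_valE.
Qed.

Let phi0l b : phi 0 b = 0.
Proof.
by have [p1 _ _ _] := Hphi; have := p1 (-1) 0 0 b; rewrite scaler0 addr0 scaleN1r addNr.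
Qed.

Let phi0r a : phi a 0 = 0.
Proof.
by have [_ p1 _ _] := Hphi; have := p1 (-1) a 0 0; rewrite scaler0 addr0 scaleN1r addNr.
Qed.

Let rho0 : rho 0 = 0.
Proof. by have [r1 _ _] := Hrho; have := r1 (-1) 0 0; rewrite scaler0 addr0 scaleN1r addNr. Qed.

Lemma modext_ann k l Y : cprod T k (0, l) Y = 0.
Proof.
have [_ [S2 _]] := HS.
congr (_, _).
  by have := S2 k (-1) 0 0 Y.1; rewrite scaler0 addr0 scaleN1r addNr.
apply: (poly_ext hK) => d; rewrite horner0.
move: k; apply: (egf_inj hK (modext_egf d (0, l) Y) (egf0 K)) => x.
by rewrite /modext_val /= phi0l rho0 !meval0 mul0r addr0.
Qed.

(** At [d = 0] the action [(d + Delta x) l(d + x)] becomes [Delta x l(x)], which determines [l]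
    because [Delta <> 0]. *)
Let modext_at0_egf l : is_egf (fun n => (cprod T n (v, 0) (0, l)).2.[0])
                     (fun x => Delta * (x * l.[x])).
Proof.
apply: eq_egf (modext_egf 0 (v, 0) (0, l)) _ _ => // x.
by rewrite /modext_val /= phi0r meval0 (rho_v Hv) !add0r mulrA.
Qed.

(* The coefficient of [d^0 l^1] in [phi_l(v, v)], where [l1 = l] and [l2 = - d - l]. *)
Definition obstruction_class : K :=
  (map_poly (horner_eval 0) (modext_prod rho phi (v, 0) (v, 0)))`_1.

Lemma modext_rel :
  Delta != 1 \/ obstruction_class = 0 -> exists k, U3_rel T (v, k).
Proof.
move=> hyp.
have [R RE] := poly_split0 (map_poly (horner_eval 0) (modext_prod rho phi (v, 0) (v, 0))).
pose c0 := (map_poly (horner_eval 0) (modext_prod rho phi (v, 0) (v, 0))).[0].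
have R0 : R.[0] = obstruction_class.
  by rewrite /obstruction_class RE coefD coefMX coefC addr0 horner_coef0.
(* This choice makes [v_x v] constant in [x] at [d = 0]. *)
pose f := - Delta^-1 *: R; pose V : C * {poly K} := (v, f).
have valV x : modext_val rho phi 0 V V x = c0.
  have := modext_valE rho phi 0 (v, 0) (v, 0) x; rewrite RE /c0 /modext_val /= horner0 mulr0.
  rewrite (rho_v Hv) hornerD hornerM hornerX hornerC addr0 !add0r hornerZ => <-.
  by field.
pose p n := cprod T n V V; pose P n := (p n).2.
(* The module component of the defect in the second relation; its [C]-component is zero since [v]
   satisfies the relation. *)
pose r := P 1%N + P 1%N - 'X * P 2%N - (f + f).
have [_ U1 _] := HU; have [U1a U1b] := U1.
have p_ge3 n : (3 <= n)%N -> p n = (0, P n).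
  by move=> /U1a e; rewrite [LHS]surjective_pairing; congr (_, _).
have p1E : p 1%N + p 1%N = cder T (p 2%N) + (V + V) + (0, r).
  congr (_, _).
    have e : cprod S 1 v v + cprod S 1 v v = cder S (cprod S 2 v v) + (v + v).
      by rewrite -!mulr2n -U1b addrCA subrr addr0.
    by rewrite [RHS]addr0; apply: e.
  rewrite -[RHS]/('X * P 2%N + (f + f) + r) -[LHS]/(P 1%N + P 1%N) /r; ring.
(* A product constant in [x] at [d = 0] has all its [n]-products with [n > 0] zero there. *)
have pconst n : (0 < n)%N -> (P n).[0] = 0.
  have val x : modext_val rho phi 0 V V x = c0 + 0 * x + 0 * x ^+ 2.
    by rewrite valV !mul0r !addr0.
  have [_ e1 e2 e3] := egf_quadratic hK (modext_egf 0 V V) val.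
  case: n => [//|[_|[_|n _]]]; [exact: e1 | | exact: e3].
  by rewrite -[RHS](mul0rn K 2); apply: e2.
have V0 l n : snd_at0 (cprod T n V (0, l)) = (cprod T n (v, 0) (0, l)).2.[0].
  have -> : V = (v, 0) + (0, f) by congr (_, _); rewrite ?addr0 ?add0r.
  by rewrite (conf_addl HT) modext_ann addr0.
(* The polynomial [Delta x l(x)] has constant term [0] and linear coefficient [Delta l(0)]. *)
have coef0 l : (cprod T 0 (v, 0) (0, l)).2.[0] = 0 /\
    (cprod T 1 (v, 0) (0, l)).2.[0] = Delta * l.[0].
  have [l' lE] := poly_split0 l.
  have l'E x : Delta * (x * l.[x]) = (Delta *: (l * 'X)).[x].
    by rewrite hornerZ hornerM hornerX; ring.
  have := egf_inj hK (modext_at0_egf l) (egf_poly hK idfun (Delta *: (l * 'X))) => e.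
  rewrite !e; try by move=> x; rewrite l'E map_poly_id.
  by rewrite /= !mulr1n !coefZ !coefMX /= mulr0 horner_coef0.
have h1 n k : (3 <= n)%N -> cprod T k (p n) V = 0.
  by move=> le3; rewrite p_ge3 // modext_ann.
have h2 k : cprod T k (0, r) V = 0 by apply: modext_ann.
have h3 X : snd_at0 (cder T X) = 0 by rewrite /snd_at0 /= hornerM hornerX mul0r.
have h4 n : (3 <= n)%N -> snd_at0 (cprod T 0 V (p n)) = 0.
  by move=> le3; rewrite p_ge3 // V0; apply: (coef0 _).1.
have h5 n : (3 <= n)%N -> snd_at0 (cprod T 1 V (p n)) = 0.
  by move=> le3; rewrite p_ge3 // V0 (coef0 _).2 pconst ?mulr0 // (leq_trans _ le3).
have ge3 m n : (3 <= n)%N -> snd_at0 (cprod T m V (p n)) = 0.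
  exact: (triple_ge3 (br := snd_at0) hK HT h1 h2 p1E pconst h4 h5).
have rr m : (2 <= m)%N -> snd_at0 (cprod T m V (0, r)) = 0.
  exact: (triple_rr (br := snd_at0) hK HT h1 h2 p1E h3 pconst h4 h5).
(* All coefficients of [Delta x (P n)(x)] vanish by [ge3]. *)
have P0 n : (3 <= n)%N -> P n = 0.
  move=> le3; apply/eqP; rewrite -(mulIr_eq0 _ (mulIf (negbT (polyX_eq0 K)))); apply/eqP.
  apply: (poly_ext hK) => x; rewrite horner0 hornerM hornerX mulrC; apply: (mulfI hDelta).
  rewrite mulr0; apply: (egf_fun_inj (modext_at0_egf (P n)) (egf0 K)) => m.
  by rewrite -V0 -p_ge3 // ge3.
(* By [rr], only the linear coefficient of [Delta x r(x)] survives, so [r] is constant. *)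
have rC : r = (r.[0])%:P.
  apply: (mulIf (negbT (polyX_eq0 K))); apply: (poly_ext hK) => x; rewrite !hornerM hornerX hornerC.
  apply: (mulfI hDelta).
  have := egf_fun_inj (modext_at0_egf r) (egf_delta 1 (Delta * r.[0])) _ x.
  rewrite invr1 mul1r expr1 => e; rewrite [r.[x] * x]mulrC e; first by ring.
  case=> [|[|m]] /=; [exact: (coef0 r).1 | exact: (coef0 r).2 |].
  by rewrite -V0 rr.
have r0 : r.[0] = 2%:R * Delta^-1 * obstruction_class.
  rewrite /r !(hornerD, hornerN, hornerM) hornerX /= pconst // hornerZ R0; ring.
(* Replacing [f] by [f + c] adds [c (d + Delta x)] to the product and so [2 Delta c - 2 c] to [r].
   This can cancel [r] if [Delta <> 1]; if the obstruction is zero, [r] is already zero. *)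
have [c cE] : exists c : K, r.[0] + (Delta * c + Delta * c) = c + c.
  case: hyp => [D1|ob0]; last by exists 0; rewrite r0 ob0 !mulr0 !addr0.
  exists (- r.[0] / ((Delta - 1) * 2%:R)); field.
  by rewrite subr_eq0 D1 natf_neq0_pchar0.
exists (f + c%:P).
have val d x : (map_poly (horner_eval d) (modext_prod rho phi (v, f + c%:P) (v, f + c%:P))).[x]
    = modext_val rho phi d V V x + (d * c + Delta * c * x + 0 * x ^+ 2).
  rewrite modext_valE /modext_val /= (rho_v Hv) hornerD hornerC; ring.
have lin d : is_egf (fun n => if n is n'.+1 then if n' is _.+1 then 0 else Delta * c else d * c)
                    (fun x => d * c + Delta * c * x + 0 * x ^+ 2).
  exists 2%N; split=> [[|[|n]] //|x].
  by rewrite !big_ord_recr big_ord0 /= fact0 (_ : 1`! = 1%N) // invr1; ring.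
have coefs d n : ((modext_prod rho phi (v, f + c%:P) (v, f + c%:P))`_n *+ n`!).[d] =
    (P n).[d] + (if n is n'.+1 then if n' is _.+1 then 0 else Delta * c else d * c).
  exact: (egf_inj hK (egf_poly hK (horner_eval d) _) (egfD (modext_egf d V V) (lin d)) (val d)).
apply: (U3_rel_sqz HU) => [n le3|]; apply: (poly_ext hK) => d.
  rewrite coefs P0 // horner0 add0r.
  by case: n le3 => [|[|n]].
have rd : r.[0] = (P 1%N).[d] + (P 1%N).[d] - d * (P 2%N).[d] - (f.[d] + f.[d]).
  by transitivity r.[d]; [rewrite {2}rC hornerC | rewrite !(hornerD, hornerN, hornerM) hornerX].
rewrite hornerD hornerN hornerM hornerX (coefs d 2%N) addr0.
have fc : (f + c%:P).[d] = f.[d] + c by rewrite hornerD hornerC.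
rewrite [X in X - _ = _]hornerMn (coefs d 1%N) [RHS]hornerMn fc 2!mulr2n.
transitivity ((f.[d] + f.[d]) + (r.[0] + (Delta * c + Delta * c))); first by rewrite rd; ring.
by rewrite cE; ring.
Qed.

End Obstruction.

(** * Cocycles and coboundaries *)

Section Divisibility.
Variables (K : fieldType) (m : nat) (s : {mpoly K[m]}).

Definition congr_mod (a b : {mpoly K[m]}) : Prop := exists q, a - b = s * q.

Lemma congr_mod_refl a : congr_mod a a.
Proof. by exists 0; rewrite subrr mulr0. Qed.

Lemma congr_modD a b a' b' :
  congr_mod a b -> congr_mod a' b' -> congr_mod (a + a') (b + b').
Proof. by move=> [q e] [q' e']; exists (q + q'); rewrite opprD addrACA e e' mulrDr. Qed.

Lemma congr_modM a b a' b' :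
  congr_mod a b -> congr_mod a' b' -> congr_mod (a * a') (b * b').
Proof.
move=> [q e] [q' e']; exists (q * a' + b * q').
have -> : a * a' - b * b' = (a - b) * a' + b * (a' - b') by ring.
by rewrite e e'; ring.
Qed.

Lemma congr_modX a b n : congr_mod a b -> congr_mod (a ^+ n) (b ^+ n).
Proof.
move=> ab; elim: n => [|n IH]; first by rewrite !expr0; apply: congr_mod_refl.
by rewrite !exprS; apply: congr_modM.
Qed.

Lemma congr_mod_comp n (t t' : n.-tuple {mpoly K[m]}) (p : {mpoly K[n]}) :
  (forall i, congr_mod (tnth t i) (tnth t' i)) ->
  congr_mod (comp_mpoly t p) (comp_mpoly t' p).
Proof.
move=> tt'; rewrite /comp_mpoly /mmap.
apply: (big_ind2 congr_mod); [exact: congr_mod_refl | exact: congr_modD | move=> k _].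
apply: congr_modM; first exact: congr_mod_refl.
apply: (big_ind2 congr_mod); [exact: congr_mod_refl | exact: congr_modM | move=> i _].
exact/congr_modX/tt'.
Qed.

(** Divisibility is stated with a boolean equality, so [xchoose] turns pointwise quotients into a
    function. *)
Lemma divide_fun (X : Type) (F : X -> {mpoly K[m]}) :
  (forall x, exists q, F x = s * q) -> exists G, forall x, F x = s * G x.
Proof.
move=> dvd; have dvdb x : exists q, F x == s * q by have [q /eqP] := dvd x; exists q.
by exists (fun x => xchoose (dvdb x)) => x; apply/eqP/(xchooseP (dvdb x)).
Qed.

Lemma meval_mul_lin c (a b : {mpoly K[m]}) t :
  (s * (c *: a + b)).@[t] = c * (s * a).@[t] + (s * b).@[t].
Proof. by rewrite mulrDr mevalD -scalerAr mevalZ. Qed.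

Lemma meval_mul_neg (a b : {mpoly K[m]}) t :
  (s * - (a * b)).@[t] = - (a.@[t] * (s * b).@[t]).
Proof. by rewrite mulrN mulrCA mevalN mevalM. Qed.

End Divisibility.

Section Lift.
Variables (K : fieldType) (n : nat).

(* The polynomial [l(- X_k)]. *)
Definition lift_neg (k : nat) (l : {poly K}) : {mpoly K[n.+1]} :=
  (map_poly (mpolyC n.+1 (R := K)) l).[- Xv K n k].

Lemma meval_lift_neg k l v : (lift_neg k l).@[v] = l.[- v (inord k)].
Proof.
have vX : (- Xv K n k).@[v] = - v (inord k) by rewrite mevalN meval_Xv.
by rewrite -vX; apply: (retract_horner (theta := meval v) (mevalC v)).
Qed.

End Lift.

Section Cohomology.
Variables (K : fieldType) (C : lmodType K) (S : confStr C) (v : C).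
Hypothesis hK : [pchar K] =i pred0.
Hypothesis HU : is_U3 S v.
Variable (Delta : K) (rho : C -> {mpoly K[2]}).
Hypothesis hDelta : Delta != 0.
Hypothesis Hrho : is_conf_module S rho.
Hypothesis Hv : rho v = Xv K 1 0 + Delta *: Xv K 1 1.

Lemma hd1_val (psi : C -> {mpoly K[2]}) a b (t : 'I_3 -> K) :
  let d := t (inord 0) in let x := t (inord 1) in let y := t (inord 2) in
  (hd1 S rho psi a b).@[t] =
    (rho a).@[point [:: d; x]] * (psi b).@[point [:: d + x; y]]
    - \sum_(k < cloc S a b) (k`!%:R)^-1 * x ^+ k *
        (psi (cprod S k a b)).@[point [:: d; x + y]].
Proof.
rewrite /= /hd1 mevalB mevalM !meval_comp2 meval_sumr mevalD !meval_Xv; congr (_ - _).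
apply: eq_bigr => k _.
by rewrite mevalM meval_lamc meval_comp2 mevalD !meval_Xv.
Qed.

Lemma hd2_val (phi : C -> C -> {mpoly K[3]}) a b c (t : 'I_4 -> K) :
  let d := t (inord 0) in let x := t (inord 1) in
  let y := t (inord 2) in let z := t (inord 3) in
  (hd2 S rho phi a b c).@[t] =
    (rho a).@[point [:: d; x]] * (phi b c).@[point [:: d + x; y; z]]
    - \sum_(k < cloc S a b) (k`!%:R)^-1 * x ^+ k *
        (phi (cprod S k a b) c).@[point [:: d; x + y; z]]
    + \sum_(k < cloc S b c) (k`!%:R)^-1 * y ^+ k *
        (phi a (cprod S k b c)).@[point [:: d; x; y + z]].
Proof.
rewrite /= /hd2 mevalD mevalB mevalM meval_comp2 meval_comp3 !meval_sumr mevalD !meval_Xv.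
congr (_ - _ + _); apply: eq_bigr => k _;
  by rewrite mevalM meval_lamc meval_comp3 mevalD !meval_Xv.
Qed.

(** The section [psi] makes [phi] a coboundary on the hyperplane [d + l1 + l2 = 0]. Off it, the
    error is divisible by [d + l1 + l2], and the quotient inherits the cochain laws because that
    factor can be cancelled. *)
Lemma cocycle_coboundary phi :
  cochain2 S phi -> cocycle_val S rho phi ->
  Delta != 1 \/ obstruction_class v rho phi = 0 -> red_coboundary2 S rho phi.
Proof.
move=> Hphi cocyc /(modext_rel hK HU hDelta Hrho Hv Hphi cocyc) [k rel].
have [psi [psi1 psi2 _ psi4]] := modext_split hK HU Hrho Hphi cocyc rel.
have [phi1 phi2 phi3 phi4] := Hphi; have [rho1 rho2 _] := Hrho.
split=> //.
(* Modulo [d + l] the variable [d] may be replaced by [- l]. The sign reconciles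
   [psi(a_x b) - a_x psi(b)] with the opposite sign convention of [hd1]. *)
pose psi' a : {mpoly K[2]} := - lift_neg 1 1 (psi a).
pose s : {mpoly K[3]} := Xv K 2 0 + Xv K 2 1 + Xv K 2 2.
have s_neq0 : s != 0.
  apply/eqP => /(congr1 (meval (point [:: 1; 0; 0]))).
  rewrite !mevalD !meval_Xv !point_inord //= meval0 !addr0 => /eqP.
  by rewrite oner_eq0.
have [G GE] : exists G : C * C -> {mpoly K[3]}, forall a b t,
    let d := t (inord 0) in let x := t (inord 1) in let y := t (inord 2) in
    (s * G (a, b)).@[t] =
    (phi a b).@[point [:: d; x; y]] - (phi a b).@[point [:: - (x + y); x; y]]
    + ((rho a).@[point [:: d; x]] - (rho a).@[point [:: - (x + y); x]]) * (psi b).[- y].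
  pose F (ab : C * C) : {mpoly K[3]} :=
    comp_mpoly [tuple Xv K 2 0; Xv K 2 1; Xv K 2 2] (phi ab.1 ab.2)
    - comp_mpoly [tuple - (Xv K 2 1 + Xv K 2 2); Xv K 2 1; Xv K 2 2] (phi ab.1 ab.2)
    + (comp_mpoly [tuple Xv K 2 0; Xv K 2 1] (rho ab.1)
       - comp_mpoly [tuple - (Xv K 2 1 + Xv K 2 2); Xv K 2 1] (rho ab.1))
      * lift_neg 2 2 (psi ab.2).
  (* Each difference in [F] replaces [d] by [- (l1 + l2)], which is congruent to it modulo [s]. *)
  have [G GE] : exists G, forall ab, F ab = s * G ab.
    apply: divide_fun => -[a b].
    have c0 : congr_mod s (Xv K 2 0) (- (Xv K 2 1 + Xv K 2 2)).
      by exists 1; rewrite mulr1 opprK addrA.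
    have refl := @congr_mod_refl K 3 s.
    have [q1 e1] : congr_mod s (comp_mpoly [tuple Xv K 2 0; Xv K 2 1; Xv K 2 2] (phi a b))
        (comp_mpoly [tuple - (Xv K 2 1 + Xv K 2 2); Xv K 2 1; Xv K 2 2] (phi a b)).
      by apply: congr_mod_comp => i; rewrite !(tnth_nth 0); case: i => [[|[|[|i]]]].
    have [q2 e2] : congr_mod s (comp_mpoly [tuple Xv K 2 0; Xv K 2 1] (rho a))
        (comp_mpoly [tuple - (Xv K 2 1 + Xv K 2 2); Xv K 2 1] (rho a)).
      by apply: congr_mod_comp => i; rewrite !(tnth_nth 0); case: i => [[|[|i]]].
    by exists (q1 + q2 * lift_neg 2 2 (psi b)); rewrite /F e1 e2 mulrDr mulrA.
  exists G => a b t; rewrite -GE /F mevalD mevalM !mevalB !meval_comp3 !meval_comp2.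
  by rewrite meval_lift_neg !mevalN !mevalD !meval_Xv.
have GI (X Y : {mpoly K[3]}) : (forall t, (s * X).@[t] = (s * Y).@[t]) -> X = Y.
  by move=> e; apply: (mulfI s_neq0); apply: (mpoly_ext hK).
have psi'E a t : (psi' a).@[t] = - (psi a).[- t (inord 1)].
  by rewrite /psi' mevalN meval_lift_neg.
exists psi', (fun a b => G (a, b)); split.
- split=> [c a b|a]; apply: (mpoly_ext hK) => t.
    rewrite [RHS]mevalD mevalZ !psi'E psi1 hornerD hornerZ; ring.
  rewrite [RHS]mevalN mevalM !psi'E psi2 meval_Xv hornerM hornerX; ring.
- split=> [c a a' b|c a b b'|a b|a b]; apply: GI => t.
  + rewrite meval_mul_lin !GE phi1 rho1 !mevalD !mevalZ; ring.
  + rewrite meval_mul_lin !GE phi2 psi1 hornerD hornerZ !mevalD !mevalZ.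
    ring.
  + rewrite meval_mul_neg !GE phi3 rho2 !mevalN !mevalM !meval_Xv.
    rewrite !point_inord //=; ring.
  + rewrite meval_mul_neg !GE phi4 psi2 hornerM hornerX !mevalN !mevalM.
    rewrite !meval_Xv !point_inord //=; ring.
move=> a b; apply: (mpoly_ext hK) => t.
rewrite [RHS]mevalD /del2 -/s GE hd1_val.
set d := t (inord 0); set x := t (inord 1); set y := t (inord 2).
have phit : (phi a b).@[t] = (phi a b).@[point [:: d; x; y]].
  apply: meval_eq => i; rewrite /point; case: i => [[|[|[|i]]] lt_i] //=;
    by congr (t _); apply: val_inj; rewrite /= inordK.
have sumE : \sum_(k < cloc S a b) (k`!%:R)^-1 * x ^+ k *
      (psi' (cprod S k a b)).@[point [:: d; x + y]]
    = - ((phi a b).@[point [:: - (x + y); x; y]]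
         + (rho a).@[point [:: - (x + y); x]] * (psi b).[- y]).
  have -> : (psi b).[- y] = (psi b).[- (x + y) + x] by congr (_.[_]); ring.
  have -> : (phi a b).@[point [:: - (x + y); x; y]]
      = (phi a b).@[point [:: - (x + y); x; - (- (x + y) + x)]].
    by apply: eq_point3 => //; ring.
  rewrite -psi4 -sumrN; apply: eq_bigr => j _.
  by rewrite psi'E point_inord //= mulrN.
rewrite phit sumE psi'E point_inord //=; ring.
Qed.

Lemma obstruction_classE phi (q : {poly K}) :
  (forall x, (phi v v).@[point [:: 0; x; - x]] = q.[x]) -> obstruction_class v rho phi = q`_1.
Proof.
move=> e; rewrite /obstruction_class.
suff -> : map_poly (horner_eval 0) (modext_prod rho phi (v, 0) (v, 0)) = q by [].
apply: (poly_ext hK) => x.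
by rewrite modext_valE /modext_val horner0 mulr0 addr0 add0r e.
Qed.

(* At [d = 0], the relation [2 v_(1) v = d (v_(2) v) + 2 v] makes the linear coefficients of the
   two terms of [hd1 psi (v, v)] cancel. *)
Lemma obstruction_class_coboundary phi :
  Delta = 1 -> red_coboundary2 S rho phi -> obstruction_class v rho phi = 0.
Proof.
move=> Delta1 [_ [psi [chi [[psi1 psi2] _ phiE]]]].
have [[_ [_ [_ [S4 _]]]] [_ U2] _] := HU.
(* At [d = 0], [l1 = x], [l2 = - x], the action of [v] shifts [d] to [x], so [psi(v)] is evaluated
   at [(x, - x)]. *)
pose g : {poly K} := mmap polyC (tnth [tuple 'X; - 'X]) (psi v).
have gE x : g.[x] = (psi v).@[point [:: x; - x]].
  have polyCK : cancel polyC (horner_eval x) by move=> k; apply: hornerC.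
  apply: etrans (retract_mmap polyCK _ _) _; apply: meval_eq => i; rewrite (tnth_nth 0) /point /=.
  by case: i => [[|[|i]]] //= _; rewrite /horner_eval ?hornerN hornerX.
pose c n := (psi (cprod S n v v)).@[point [:: 0; 0]].
have psi0 : psi 0 = 0 by have := psi1 (-1) 0 0; rewrite scaler0 addr0 scaleN1r addNr.
have cE : is_egf c (fun x => \sum_(k < cloc S v v) (k`!%:R)^-1 * x ^+ k * c k).
  by apply: egf_bounded => n /S4 e; rewrite /c e psi0 meval0.
have Q x : (map_poly (horner_eval 0) (modext_prod rho phi (v, 0) (v, 0))).[x]
    = (map_poly idfun ('X * g)).[x] + -1 * \sum_(k < cloc S v v) (k`!%:R)^-1 * x ^+ k * c k.
  rewrite modext_valE /modext_val horner0 mulr0 addr0 add0r phiE mevalD hd1_val.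
  rewrite /del2 mevalM !mevalD !meval_Xv !point_inord //= add0r subrr mul0r addr0.
  rewrite (rho_v Hv) Delta1 !add0r mul1r map_poly_id // hornerM hornerX gE mulN1r; congr (_ - _).
(* The linear coefficient is [psi(v) - psi(v (1) v)] at the origin. Doubled, it is [psi] of a
   derivative up to sign, which carries a factor [lambda = 0]. *)
have := egf_inj hK (egf_poly hK (horner_eval 0) (modext_prod rho phi (v, 0) (v, 0)))
  (egfD (egf_poly hK idfun ('X * g)) (egfZ (-1) cE)) Q 1%N.
rewrite /obstruction_class coef_map /= mulr1n => ->.
rewrite mulr1n coefXM /= -horner_coef0 gE oppr0.
have two : (2%:R : K) != 0 by apply: natf_neq0_pchar0.
have psiMn a n : psi (a *+ n) = psi a *+ n.
  elim: n => [|n IH]; first by rewrite !mulr0n.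
  by rewrite !mulrSr -IH -[_ *+ n]scale1r psi1 !scale1r.
apply: (mulIf two); rewrite mul0r mulr_natr mulrnDl mulN1r mulNrn /c.
rewrite -!mevalMn -!psiMn -[v *+ 2]U2.
have -> : cprod S 1 v v *+ 2 - cder S (cprod S 2 v v)
    = (-1) *: cder S (cprod S 2 v v) + cprod S 1 v v *+ 2 by rewrite scaleN1r addrC.
rewrite psi1 psi2 mevalD mevalZ mevalN mevalM meval_Xv point_inord //= mul0r oppr0 mulr0 add0r.
by rewrite subrr.
Qed.

Hypothesis Delta1 : Delta = 1.

(* Cup product of the deformation [rho'] of the module with the derivation [fb]. *)
Lemma fundamental_cocycle : exists B, red_cocycle2 S rho B /\ obstruction_class v rho B = 1.
Proof.
have [rho' [r1 r2 r3 r4]] := module_deformation hK HU Hrho Hv.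
have [fb [f1 f2 f3 f4]] := module_derivation hK HU Hrho Hv Delta1.
have [rho1 rho2 _] := Hrho.
(* The action shifts [d] to [d + l1], which is [- l2] modulo [d + l1 + l2]. *)
pose B a b : {mpoly K[3]} := comp_mpoly [tuple Xv K 2 0; Xv K 2 1] (rho' a) * lift_neg 2 2 (fb b).
have BE a b (t : 'I_3 -> K) :
    (B a b).@[t] = (rho' a).@[point [:: t (inord 0); t (inord 1)]] * (fb b).[- t (inord 2)].
  by rewrite mevalM meval_comp2 meval_lift_neg !meval_Xv.
exists B; split; last first.
  rewrite (@obstruction_classE B 'X) ?coefX // => x.
  by rewrite BE r3 f3 !point_inord //= meval_Xv point_inord // hornerC mulr1 hornerX.
split.
  split=> [c a a' b|c a b b'|a b|a b]; apply: (mpoly_ext hK) => t.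
  - rewrite BE [RHS]mevalD mevalZ !BE r1 mevalD mevalZ; ring.
  - rewrite BE [RHS]mevalD mevalZ !BE f1 hornerD hornerZ; ring.
  - rewrite BE [RHS]mevalN mevalM !BE r2 mevalN mevalM !meval_Xv point_inord //=; ring.
  - rewrite BE [RHS]mevalN mevalM !BE f2 hornerM hornerX meval_Xv; ring.
pose s : {mpoly K[4]} := Xv K 3 0 + Xv K 3 1 + Xv K 3 2 + Xv K 3 3.
have s_neq0 : s != 0.
  apply/eqP => /(congr1 (meval (point [:: 1; 0; 0; 0]))).
  rewrite !mevalD !meval_Xv !point_inord //= meval0 !addr0 => /eqP.
  by rewrite oner_eq0.
(* By the identities for [rho'] and [fb], [hd2] of [B] reduces to [rho' a] times [D b] times [fb e].
   The two arguments [d + l1] and [- (l2 + l3)] in [D b] agree modulo [s]. *)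
pose D b : {mpoly K[4]} := comp_mpoly [tuple - (Xv K 3 2 + Xv K 3 3); Xv K 3 2] (rho b)
  - comp_mpoly [tuple Xv K 3 0 + Xv K 3 1; Xv K 3 2] (rho b).
have DE b (t : 'I_4 -> K) : (D b).@[t] =
    (rho b).@[point [:: - (t (inord 2) + t (inord 3)); t (inord 2)]]
    - (rho b).@[point [:: t (inord 0) + t (inord 1); t (inord 2)]].
  by rewrite mevalB !meval_comp2 mevalN !mevalD !meval_Xv.
have [G GE] : exists G, forall b, D b = s * G b.
  apply: divide_fun => b; apply: congr_mod_comp => i; rewrite !(tnth_nth 0).
  case: i => [[|[|i]]] //= _; last exact: congr_mod_refl.
  by exists (-1); rewrite /s; ring.
have GI (X Y : {mpoly K[4]}) : (forall t, (s * X).@[t] = (s * Y).@[t]) -> X = Y.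
  by move=> e; apply: (mulfI s_neq0); apply: (mpoly_ext hK).
have [chi chiE] : exists chi : C -> C -> C -> {mpoly K[4]}, forall a b e t,
    (s * chi a b e).@[t] =
    (rho' a).@[point [:: t (inord 0); t (inord 1)]] * (fb e).[- t (inord 3)] *
    ((rho b).@[point [:: - (t (inord 2) + t (inord 3)); t (inord 2)]]
     - (rho b).@[point [:: t (inord 0) + t (inord 1); t (inord 2)]]).
  exists (fun a b e =>
    comp_mpoly [tuple Xv K 3 0; Xv K 3 1] (rho' a) * lift_neg 3 3 (fb e) * G b) => a b e t.
  by rewrite mulrCA -GE !mevalM DE meval_comp2 meval_lift_neg !meval_Xv.
exists chi; split.
  split; [|split; [|split; [|split; [|split]]]].
  - move=> c a a' b e; apply: GI => t.
    rewrite meval_mul_lin !chiE r1 mevalD mevalZ; ring.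
  - move=> c a b b' e; apply: GI => t.
    rewrite meval_mul_lin !chiE rho1 !mevalD !mevalZ; ring.
  - move=> c a b e e'; apply: GI => t.
    rewrite meval_mul_lin !chiE f1 hornerD hornerZ; ring.
  - move=> a b e; apply: GI => t.
    rewrite meval_mul_neg !chiE r2 mevalN mevalM !meval_Xv point_inord //=; ring.
  - move=> a b e; apply: GI => t.
    rewrite meval_mul_neg !chiE rho2 !mevalN !mevalM !meval_Xv !point_inord //=.
    ring.
  - move=> a b e; apply: GI => t.
    rewrite meval_mul_neg !chiE f2 hornerM hornerX meval_Xv; ring.
move=> a b e; apply: (mpoly_ext hK) => t.
rewrite /del3 -/s chiE hd2_val.
set d := t (inord 0); set x := t (inord 1); set y := t (inord 2); set z := t (inord 3).
have -> : \sum_(k < cloc S a b) (k`!%:R)^-1 * x ^+ k *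
    (B (cprod S k a b) e).@[point [:: d; x + y; z]]
    = ((rho a).@[point [:: d; x]] * (rho' b).@[point [:: d + x; y]]
       + (rho' a).@[point [:: d; x]] * (rho b).@[point [:: d + x; y]]) * (fb e).[- z].
  have {2 3}-> : y = x + y - x by ring.
  rewrite -r4 mulr_suml; apply: eq_bigr => k _.
  by rewrite BE !point_inord //= mulrA.
have -> : \sum_(k < cloc S b e) (k`!%:R)^-1 * y ^+ k *
    (B a (cprod S k b e)).@[point [:: d; x; y + z]]
    = (rho' a).@[point [:: d; x]] *
      ((rho b).@[point [:: - (y + z); y]] * (fb e).[- z]).
  have -> : - z = - (y + z) + y by ring.
  rewrite -f4 mulr_sumr; apply: eq_bigr => k _.
  by rewrite BE !point_inord //= mulrCA.
by rewrite BE !point_inord //=; ring.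
Qed.

End Cohomology.

(** * Computation of the dimension *)

Lemma cochain2_sub (K : fieldType) (C : lmodType K) (S : confStr C) k phi phi' :
  cochain2 S phi -> cochain2 S phi' -> cochain2 S (fun a b => phi a b - k *: phi' a b).
Proof.
move=> [p1 p2 p3 p4] [q1 q2 q3 q4].
have lin c (x x' y y' : {mpoly K[3]}) :
    c *: x + x' - k *: (c *: y + y') = c *: (x - k *: y) + (x' - k *: y').
  by rewrite -!mul_mpolyC; ring.
have der (X x y : {mpoly K[3]}) : - (X * x) - k *: - (X * y) = - (X * (x - k *: y)).
  by rewrite -!mul_mpolyC; ring.
by split=> *; rewrite ?p1 ?q1 ?p2 ?q2 ?p3 ?q3 ?p4 ?q4.
Qed.

Lemma cocycle_val_sub (K : fieldType) (C : lmodType K) (S : confStr C) rho k phi phi' :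
  cocycle_val S rho phi -> cocycle_val S rho phi' ->
  cocycle_val S rho (fun a b => phi a b - k *: phi' a b).
Proof.
move=> p q a b c d x y.
have sumE n (w : nat -> K) (F G : nat -> {mpoly K[3]}) t :
    \sum_(i < n) w i * (F i - k *: G i).@[t] =
    \sum_(i < n) w i * (F i).@[t] - k * \sum_(i < n) w i * (G i).@[t].
  rewrite mulr_sumr -sumrB; apply: eq_bigr => i _.
  by rewrite mevalB mevalZ; ring.
rewrite (sumE _ (fun i => (i`!%:R)^-1 * y ^+ i) (fun i => phi a (cprod S i b c))
  (fun i => phi' a (cprod S i b c))).
rewrite (sumE _ (fun i => (i`!%:R)^-1 * x ^+ i) (fun i => phi (cprod S i a b) c)
  (fun i => phi' (cprod S i a b) c)) -p -q mevalB mevalZ; ring.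
Qed.

Lemma eq_red_coboundary2 (K : fieldType) (C : lmodType K) (S : confStr C) rho phi phi' :
  (forall a b, phi a b = phi' a b) -> red_coboundary2 S rho phi -> red_coboundary2 S rho phi'.
Proof.
move=> e [[p1 p2 p3 p4] [psi [chi [cpsi cchi E]]]].
split; first by split=> *; rewrite -!e.
by exists psi, chi; split=> // a b; rewrite -e.
Qed.

Theorem theorem4p4 (K : fieldType) (hK : [pchar K] =i pred0)
    (C : lmodType K) (S : confStr C) (v : C) (HU : is_U3 S v)
    (Delta : K) (hDelta : Delta != 0)
    (rho : C -> {mpoly K[2]}) (Hrho : is_conf_module S rho)
    (Hv : rho v = Xv K 1 0 + Delta *: Xv K 1 1) :
  (Delta = 1 -> H2_dim S rho 1) /\ (Delta <> 1 -> H2_dim S rho 0).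
Proof.
split=> [Delta1|/eqP DeltaN1]; last first.
  exists (fun _ _ _ => 0); split=> [[]//|c _ []//|phi Zphi]; exists (fun=> 0).
  apply: (@eq_red_coboundary2 _ _ _ _ phi) => [a b|]; first by rewrite big_ord0 subr0.
  apply: (cocycle_coboundary hK HU hDelta Hrho Hv Zphi.1 (red_cocycle2_val Zphi)).
  by left.
have [B [ZB classB]] := fundamental_cocycle hK HU Hrho Hv Delta1.
(* The polynomial [Q phi] is [phi_x(v, v)] at [d = 0]; its values depend linearly on [phi], hence so
   does the obstruction class. *)
have [Q [Q1 QE]] : exists Q : (C -> C -> {mpoly K[3]}) -> {poly K},
    (forall phi, (Q phi)`_1 = obstruction_class v rho phi) /\
    (forall phi x, (Q phi).[x] = (phi v v).@[point [:: 0; x; - x]]).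
  exists (fun phi => map_poly (horner_eval 0) (modext_prod rho phi (v, 0) (v, 0))).
  split=> // phi x.
  by rewrite modext_valE /modext_val horner0 mulr0 addr0 add0r.
exists (fun=> B); split=> [//|c bd i|phi Zphi].
  have := obstruction_class_coboundary hK HU Hv Delta1 bd.
  rewrite (obstruction_classE hK rho (q := c i *: Q B)) => [|x].
    by rewrite coefZ Q1 classB mulr1.
  by rewrite big_ord1 mevalZ hornerZ QE (ord1 i).
(* Since [B] has class [1], subtracting [k *: B] leaves a cocycle of class zero, which is a
   coboundary. *)
pose k := obstruction_class v rho phi; exists (fun=> k).
apply: (@eq_red_coboundary2 _ _ _ _ (fun a b => phi a b - k *: B a b)) => [a b|].
  by rewrite big_ord1.
apply: (cocycle_coboundary hK HU hDelta Hrho Hv (cochain2_sub _ Zphi.1 ZB.1)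
  (cocycle_val_sub _ (red_cocycle2_val Zphi) (red_cocycle2_val ZB))).
right; rewrite (obstruction_classE hK rho (q := Q phi - k *: Q B)) => [|x].
  by rewrite coefB coefZ !Q1 classB mulr1 subrr.
by rewrite hornerD hornerN hornerZ !QE mevalB mevalZ.
Qed.
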